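(* Let $E\subseteq \mathbb{F}_q^2$ with $|E|\geq cq^{\frac{15}{8}}$ for $c$ sufficiently large. Let $$ f(x,y)=Ax^2+Bxy+Cy^2+Dx+E'y+F $$ with coefficients in $\mathbb{F}_q$, and let $Z_f\subseteq\mathbb{F}_q^2$ be the zero set of $f$. Suppose that $$ \det\begin{pmatrix} A & B/2 & D/2 \\ B/2 & C & E'/2 \\ D/2 & E'/2 & F \end{pmatrix}\neq 0. $$ If $$ \det\begin{pmatrix} A & B/2 \\ B/2 & C \end{pmatrix}\neq 0, $$ then there exists a translation $S$ of $Z_f$ such that $$ 2\leq \mathrm{VCdim}(\mathcal{H}_{Z_f}(E))\leq \mathrm{VCdim}(\mathcal{H}_S(E))=3. $$ Otherwise, if the quadratic part is degenerate (i.e. the $2\times 2$ determinant above is $0$), then $\mathrm{VCdim}(\mathcal{H}_S(E))=2$ for any translation $S$ of $Z_f$, and in this case $$ \mathrm{VCdim}(\mathcal{H}_T(E))\geq 3, $$ where $T=S\cup(-S)$.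
   Context: $\mathbb{F}_q$ is a finite field with $q$ elements, $q$ odd, and results are asymptotic as $q\to\infty$. For $E,S\subseteq\mathbb{F}_q^d$, the hypothesis class $\mathcal{H}_S(E)$ has domain $E$ and consists of the functions $h_y$, $y\in E$, where $h_y(x)=1$ if $x-y\in S$ and $h_y(x)=0$ otherwise. A class $\mathcal{H}$ of functions $X\to\{0,1\}$ shatters a finite $C\subseteq X$ if restricting $\mathcal{H}$ to $C$ yields every function $C\to\{0,1\}$; $\mathrm{VCdim}(\mathcal{H})$ is the largest $n$ such that some set of size $n$ is shattered. For a set $S$, $-S=\{-s: s\in S\}$. *)

(* Defs.v *)
From HB Require Import structures.
From mathcomp Require Import all_boot all_order all_algebra all_field.
From mathcomp Require Import reals exp.

Set Implicit Arguments.
Unset Strict Implicit.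
Unset Printing Implicit Defensive.

Import Order.TTheory GRing.Theory Num.Theory.
Local Open Scope ring_scope.

Section VC.
Variable X : finType.

Definition shatters (H : {set {ffun X -> bool}}) (C : {set X}) : bool :=
  [forall g : {ffun {x : X | x \in C} -> bool},
     exists h in H, forall x : {x : X | x \in C}, h (val x) == g x].

(* The maximum over an empty range is 0; this happens only for the empty class,
   since a nonempty class shatters the empty set. *)
Definition VCdim (H : {set {ffun X -> bool}}) : nat :=
  \max_(C : {set X} | shatters H C) #|C|.

End VC.

Section Points.
Variables (K : finFieldType) (d : nat).
Implicit Types S E Z : {set 'rV[K]_d}.

Definition hclass S E : {set {ffun {x : 'rV[K]_d | x \in E} -> bool}} :=
  [set [ffun x : {x : 'rV[K]_d | x \in E} => val x - y \in S] | y in E].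

Definition is_translation S Z : Prop :=
  exists t : 'rV[K]_d, S = [set z + t | z in Z].

Definition opp_set S : {set 'rV[K]_d} := [set - s | s in S].

End Points.

Section Conic.
Variable K : finFieldType.
Variables A B C D E' F : K.

Definition conic_poly (x y : K) : K :=
  A * x ^+ 2 + B * x * y + C * y ^+ 2 + D * x + E' * y + F.

Definition conic_zeros : {set 'rV[K]_2} :=
  [set v : 'rV[K]_2 | conic_poly (v 0 0) (v 0 1) == 0].

Definition conic_mx : 'M[K]_3 :=
  \matrix_(i < 3, j < 3)
    (nth [::] [:: [:: A;     B / 2;  D / 2];
                  [:: B / 2; C;      E' / 2];
                  [:: D / 2; E' / 2; F]] i)`_j.

Definition conic_quad_mx : 'M[K]_2 :=
  \matrix_(i < 2, j < 2)
    (nth [::] [:: [:: A;     B / 2];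
                  [:: B / 2; C]] i)`_j.

End Conic.

(* Main.v *)
(** A three-point shattered configuration is a cube: if [s1, s2, s3] lie in [S] and the
    points [y], [y + si], [y + si + sj] lie in [E], then the [x_i := y + s_i] are seen
    together by [y], in pairs by the [y + si + sj], and, up to boundedly many bad choices
    of [s_i], by nothing else; translates seeing at most one of the [x_i] are plentiful.
    The cube is built one direction at a time: passing from [P] to [P :&: (P - s)] for a
    popular [s] in [S] squares the density, and an expander mixing inequality with error
    [2 sqrt q] allows three such steps exactly when [E] has size at least [c q^(15/8)].
    The upper bounds hold because two distinct translates of the conic meet in at most two
    points (one for a parabola).

    The mixing inequality says that the Fourier coefficients of a conic are [O(sqrt q)].
    For a parabola they are Gauss sums; for a central conic they are Kloosterman sums [K],
    so Weil's bound [|K| <= 2 sqrt q] is needed. On the quadratic extension of a field with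
    [Q] elements [K] becomes [2 Q - K^2], so a sum exceeding [2 sqrt q] would grow without
    bound, relative to [sqrt Q], along the tower of quadratic extensions. But on every
    level the sum is an average of point counts of the curves
    [w^2 = (y^q - y + u)^2 - 4 a], whose degree does not depend on the level, and
    Stepanov's method bounds these with an error [O_q(sqrt Q)]. *)

Require Import Defs.
From HB Require Import structures.
From mathcomp Require Import all_boot all_order all_algebra all_field.
From mathcomp Require Import reals exp.
From mathcomp Require Import zify ring lra.

Set Implicit Arguments.
Unset Strict Implicit.
Unset Printing Implicit Defensive.

Import Order.TTheory GRing.Theory Num.Theory.
Local Open Scope ring_scope.

(** * Stepanov's method for [w^2 = D(y)] *)

(** Forces [M] to be a power of the characteristic, in the form under which [x ^+ M] is additive. *)
Lemma finField_pnat (F : finFieldType) (M k : nat) :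
  (0 < k)%N -> #|F| = (M ^ k)%N -> [char F].-nat M.
Proof.
move=> k0 cardF; have [p p_pr pF] := finPcharP F.
rewrite (eq_pnat _ (pcharf_eq pF)).
have pnQ : p.-nat #|F|.
  by rewrite [X in _.-nat X](card_pprimeChar pF) pnatX pnat_id ?orbT.
by apply: pnat_dvd pnQ; rewrite cardF dvdn_exp.
Qed.

Lemma pchar_poly_nat (F : fieldType) n : [char F].-nat n -> [char {poly F}].-nat n.
Proof. by rewrite (eq_pnat _ (@pchar_poly F)). Qed.

Lemma exprn_sum_pchar (R : comNzRingType) n I (r : seq I) (P : pred I) (f : I -> R) :
  [char R].-nat n -> (\sum_(i <- r | P i) f i) ^+ n = \sum_(i <- r | P i) f i ^+ n.
Proof.
move=> nR; elim/big_rec2: _ => [|i y x _ <-]; last exact: exprDn_pchar.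
by rewrite expr0n; case: n nR.
Qed.

(** With [A / B] in lowest terms, [b ^+ 2] divides the coprime [a ^+ 2], so [b] is constant; then
    [a * a] divides [D], separability makes [a] constant, and [D] would be constant too. *)
Lemma separable_not_square_ratio (F : fieldType) (D A B : {poly F}) (c : F) :
  separable_poly D -> (1 < size D)%N -> B != 0 -> A ^+ 2 = c *: (D * B ^+ 2) ->
  c != 0 -> False.
Proof.
move=> sepD sD B0 E c0.
have G0 : gcdp A B != 0 by rewrite gcdp_eq0 negb_and B0 orbT.
pose G := gcdp A B; pose a : {poly F} := A %/ G; pose b : {poly F} := B %/ G.
have EA : a * G = A by rewrite divpK // dvdp_gcdl.
have EB : b * G = B by rewrite divpK // dvdp_gcdr.
have cop : coprimep a b by apply: coprimep_div_gcd; rewrite B0 orbT.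
have {}E : a ^+ 2 = c *: (D * b ^+ 2).
  apply: (@mulIf _ (G ^+ 2)); first by rewrite expf_neq0.
  by rewrite -exprMn EA E -EB -!mul_polyC; ring.
have b1 : b ^+ 2 %| a ^+ 2 by rewrite E dvdpZr // dvdp_mull.
have sb : size b = 1%N.
  have := coprimep_expl 2 (coprimep_expr 2 cop); rewrite coprimep_sym => cop2.
  have : coprimep (b ^+ 2) (b ^+ 2) by apply: coprimep_dvdl cop2.
  rewrite coprimepp; have b0 : b != 0 by apply: contraNneq B0; rewrite -EB => ->; rewrite mul0r.
  move/eqP=> s2; have H : (size (b ^+ 2)).-1 = ((size b).-1 * 2)%N := size_exp b 2.
  move: b0 H; rewrite -size_poly_gt0 [size (b ^+ 2)]s2; case: (size b) => [|[|n]] //=.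
have /eqP/size_poly1P[k k0 Eb] := sb.
have : a * a %| D.
  by rewrite -expr2 E Eb dvdpZl // -polyC_exp mulrC mul_polyC dvdpZl ?expf_neq0.
have [+ _] := separable_polyP sepD; move=> H /H; rewrite coprimepp => /eqP sa.
have := congr1 (fun p : {poly F} => size p) E.
rewrite Eb size_scale // -polyC_exp mulrC mul_polyC size_scale ?expf_neq0 //.
have H2 : (size (a ^+ 2)).-1 = ((size a).-1 * 2)%N := size_exp a 2.
by move: H2 sD => + + E2; rewrite E2 [size a]sa; case: (size D) => [|[|n]].
Qed.

(** Coefficients of degree below [M] do not overlap after the substitution of ['X^M]: this is
    uniqueness of the expansion in base ['X^M], read off modulo ['X^M] one coefficient at a time. *)
Lemma horner_Xn_eq0 (F : fieldType) (M : nat) (P : {poly {poly F}}) :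
  (forall j, (size (P`_j)%R <= M)%N) -> P.['X^M] = 0 -> P = 0.
Proof.
elim/poly_ind: P => [//|P c IH] sP.
rewrite hornerMXaddC => E.
have sc : (size c <= M)%N by have := sP 0%N; rewrite coefD coefMX coefC /= add0r.
have Ec : c = 0.
  have : c %% 'X^M = (- (P.['X^M] * 'X^M)) %% 'X^M by congr (_ %% _); apply/eqP; rewrite -addr_eq0 addrC E.
  by rewrite modpN modp_mull oppr0 modp_small // size_polyXn ltnS.
have EP : P.['X^M] = 0.
  by move/eqP: E; rewrite Ec addr0 mulf_eq0 expf_eq0 polyX_eq0 andbF orbF => /eqP.
rewrite Ec addr0 IH ?mul0r // => j.
by have := sP j.+1; rewrite coefD coefMX coefC /= addr0.
Qed.

Definition coef_size_le (F : fieldType) n (P : {poly {poly F}}) :=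
  forall j, (size (P`_j)%R <= n)%N.

Lemma size_sum_leq (R : nzSemiRingType) I (r : seq I) (P : pred I) (f : I -> {poly R}) n :
  (forall i, P i -> (size (f i) <= n)%N) -> (size (\sum_(i <- r | P i) f i)%R <= n)%N.
Proof.
by move=> H; apply: leq_trans (size_sum _ _ _) _; elim/big_rec: _ => // i x /H; rewrite geq_max => ->.
Qed.

Lemma coef_size_leM (F : fieldType) n m (P Q : {poly {poly F}}) :
  coef_size_le n P -> coef_size_le m Q -> coef_size_le (n + m) (P * Q).
Proof.
move=> hP hQ j; rewrite coefM; apply: size_sum_leq => i _.
by apply: leq_trans (size_polyMleq _ _) _; have := hP i; have := hQ (j - i)%N; lia.
Qed.
Lemma card_sqrt_le2 (F : finFieldType) (t : F) : (#|[set w : F | w ^+ 2 == t]| <= 2)%N.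
Proof.
have XD0 : 'X^2 - t%:P != 0 :> {poly F} by rewrite -size_poly_eq0 size_XnsubC.
have := @max_poly_roots _ _ (enum [set w : F | w ^+ 2 == t]) XD0.
rewrite enum_uniq -cardE size_XnsubC // ltnS; apply => //.
by apply/allP => w; rewrite mem_enum inE => /eqP Ew; rewrite /root !hornerE Ew subrr.
Qed.

Section Stepanov.
Variables (F : finFieldType) (M : nat).
Hypothesis cardF : #|F| = (M ^ 2)%N.

Let MF : [char F].-nat M. Proof. exact: finField_pnat cardF. Qed.

Let MFX : [char {poly F}].-nat M. Proof. exact: pchar_poly_nat. Qed.

Let frobK (x : F) : x ^+ M ^+ M = x.
Proof. by rewrite -exprM mulnn -cardF expf_card. Qed.

Variables (m l : nat).
Implicit Types a b : 'M[F]_(m, l).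

(* With [z] standing for ['X^M], [step_bi a] is the bivariate polynomial
   [\sum a k i y^i z^k]. Since [y^(M^2) = y] on [F], the function [step_poly a ^+ M] is
   also given by [step_dual a], whose low degree leaves few conditions to impose. *)
Definition step_bi a : {poly {poly F}} :=
  \sum_(k < m) (\sum_(i < l) a k i *: 'X^i)%:P * 'X^k.

Definition step_poly a : {poly F} :=
  \sum_(k < m) \sum_(i < l) a k i *: 'X^(i + k * M).

Definition step_dual a : {poly F} :=
  \sum_(k < m) \sum_(i < l) (a k i ^+ M) *: 'X^(i * M + k).

Lemma step_bi_horner a : (step_bi a).['X^M] = step_poly a.
Proof.
rewrite /step_bi horner_sum; apply: eq_bigr => k _.
rewrite hornerM hornerC hornerXn mulr_suml; apply: eq_bigr => i _.
by rewrite -scalerAl -exprM -exprD [(M * k)%N]mulnC.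
Qed.

Lemma step_bi_coef a (k : 'I_m) : (step_bi a)`_k = \sum_(i < l) a k i *: 'X^i.
Proof.
rewrite /step_bi coef_sum (bigD1 k) //= [X in _ + X]big1 ?addr0 => [|j jk].
  by rewrite coefCM coefXn eqxx mulr1.
by rewrite coefCM coefXn [_ == _]eq_sym val_eqE (negbTE jk) mulr0.
Qed.

Lemma step_bi_size a : coef_size_le l (step_bi a).
Proof.
move=> j; rewrite /step_bi coef_sum; apply: size_sum_leq => k _.
rewrite coefCM coefXn; case: eqP => _; last by rewrite mulr0 size_poly0.
rewrite mulr1; apply: size_sum_leq => i _.
by apply: leq_trans (size_scale_leq _ _) _; rewrite size_polyXn ltn_ord.
Qed.

Lemma step_bi_eq0 a : step_bi a = 0 -> a = 0.
Proof.
move=> E; apply/matrixP=> k i; rewrite mxE.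
have /(congr1 (fun p : {poly F} => p`_i)) := step_bi_coef a k.
rewrite E !coef0 coef_sum (bigD1 i) //= big1 ?addr0 => [|j ji].
  by rewrite coefZ coefXn eqxx mulr1 => <-.
by rewrite coefZ coefXn [_ == _]eq_sym val_eqE (negbTE ji) mulr0.
Qed.

Lemma step_poly_exp a y : (step_poly a).[y] ^+ M = (step_dual a).[y].
Proof.
rewrite /step_poly /step_dual !horner_sum exprn_sum_pchar //; apply: eq_bigr => k _.
rewrite !horner_sum exprn_sum_pchar //; apply: eq_bigr => i _.
rewrite !hornerZ !hornerXn exprMn; congr (_ * _).
by rewrite !exprD exprMn -exprM; congr (_ * _); rewrite exprM frobK.
Qed.

Lemma step_dualB a b : step_dual (a - b) = step_dual a - step_dual b.
Proof.
rewrite /step_dual -sumrB; apply: eq_bigr => k _; rewrite -sumrB.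
apply: eq_bigr => i _; rewrite -scalerBl !mxE.
by rewrite exprDn_pchar // exprNn_pchar.
Qed.

Lemma size_step_poly a : (size (step_poly a) <= m * M + l)%N.
Proof.
apply: size_sum_leq => k _; apply: size_sum_leq => i _.
apply: leq_trans (size_scale_leq _ _) _; rewrite size_polyXn.
have := ltn_ord k; have := ltn_ord i; nia.
Qed.

Lemma size_step_dual a : (size (step_dual a) <= l * M + m)%N.
Proof.
apply: size_sum_leq => k _; apply: size_sum_leq => i _.
apply: leq_trans (size_scale_leq _ _) _; rewrite size_polyXn.
have := ltn_ord k; have := ltn_ord i; nia.
Qed.

(** The map [f] is additive but not linear, since [step_dual] raises coefficients to the power [M].
    The dimension count is therefore a pigeonhole on cardinalities, and the kernel element is the
    difference of two colliding pairs. *)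
Lemma step_kernel (W : {poly F}) n :
  (size W <= n.+1)%N -> (l * M + m + n < 2 * (m * l))%N ->
  exists2 ab : 'M[F]_(m, l) * 'M[F]_(m, l),
    ab != 0 & step_dual ab.1 + W * step_dual ab.2 = 0.
Proof.
move=> sW dim; pose N := (l * M + m + n)%N.
pose T := ('M[F]_(m, l) * 'M[F]_(m, l))%type.
pose f (ab : T) : {poly F} := step_dual ab.1 + W * step_dual ab.2.
have sf ab : (size (f ab) <= N)%N.
  apply: leq_trans (size_polyD _ _) _; rewrite geq_max.
  apply/andP; split; first by apply: leq_trans (size_step_dual _) _; rewrite /N; lia.
  apply: leq_trans (size_polyMleq _ _) _.
  by have := size_step_dual ab.2; rewrite /N; lia.
pose g (ab : T) : 'rV[F]_N := poly_rV (f ab).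
have : ~~ injectiveb g.
  apply/negP => /injectiveP/leq_card; rewrite card_prod !card_mx -expnD mul1n.
  rewrite leq_exp2l ?finNzRing_gt1 //.
  by move: dim; rewrite /N; lia.
case/injectivePn => x [y xy E]; exists (x - y); first by rewrite subr_eq0.
have : f x = f y by rewrite -(poly_rV_K (sf x)) -(poly_rV_K (sf y)) -/(g x) E.
rewrite /f /= !step_dualB => Exy.
transitivity (f x - f y); last by rewrite /f Exy subrr.
by rewrite /f; ring.
Qed.

(* Were the auxiliary polynomial zero, squaring it and reading the result in the independent
   variables [y] and ['X^M] would make [D] a square up to a constant. *)
Lemma step_nonzero (D : {poly F}) (ab : 'M[F]_(m, l) * 'M[F]_(m, l)) (h : nat) :
  separable_poly D -> (1 < size D)%N -> (2 * h = M.+1)%N ->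
  (2 * l + size D < M)%N -> ab != 0 ->
  step_poly ab.1 + D ^+ h * step_poly ab.2 != 0.
Proof.
move=> sepD sD hM dM; case: ab => a b /= ab0; apply/negP => /eqP E.
have D0 : D != 0 by rewrite -size_poly_gt0; apply: leq_trans sD.
have lc0 : (lead_coef D ^+ M)%:P != 0 :> {poly F}.
  by rewrite polyC_eq0 expf_neq0 // lead_coef_eq0.
(* Raising to the power [M] turns [D] into a polynomial in ['X^M]; [Dz] is that polynomial in the
   second variable. As [2 * h = M.+1], the square of [D ^+ h] is [D * D ^+ M], of low degree in the
   first variable. *)
pose Dz : {poly {poly F}} := \poly_(i < size D) (D`_i ^+ M)%:P.
have lcDz : lead_coef Dz = (lead_coef D ^+ M)%:P.
  by rewrite lead_coef_poly ?size_poly_gt0 // -lead_coefE.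
have DzE : Dz.['X^M] = D ^+ M.
  have -> : D ^+ M = (\poly_(i < size D) D`_i) ^+ M by rewrite coefK.
  rewrite poly_def exprn_sum_pchar // horner_poly.
  apply: eq_bigr => i _; rewrite exprZn -!exprM mulnC mul_polyC //.
have sDz : coef_size_le 1 Dz.
  move=> j; rewrite coef_poly; case: ifP => _; last by rewrite size_poly0.
  by rewrite size_polyC; case: (_ == _).
have sqE : step_poly a ^+ 2 = D * D ^+ M * step_poly b ^+ 2.
  have -> : step_poly a = - (D ^+ h * step_poly b) by apply/eqP; rewrite -addr_eq0 E.
  by rewrite sqrrN exprMn -exprM mulnC hM exprS.
have biE : step_bi a ^+ 2 = D%:P * Dz * step_bi b ^+ 2.
  apply/eqP; rewrite -subr_eq0; apply/eqP; apply: (@horner_Xn_eq0 _ M) => [j|].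
    rewrite coefB; apply: leq_trans (size_polyD _ _) _; rewrite size_polyN geq_max.
    have s2 c : coef_size_le (l + l) (step_bi c ^+ 2).
      by rewrite expr2; apply: coef_size_leM; apply: step_bi_size.
    have sDP : coef_size_le (size D) D%:P.
      by move=> k; rewrite coefC; case: ifP => // _; rewrite size_poly0.
    have := coef_size_leM (coef_size_leM sDP sDz) (s2 b) j; have := s2 a j; move: dM.
    by move=> dM H1 H2; apply/andP; split; [apply: leq_trans H1 _|apply: leq_trans H2 _]; lia.
  by rewrite hornerD hornerN !expr2 !hornerM hornerC !step_bi_horner DzE -!expr2 sqE subrr.
have := congr1 (fun p : {poly {poly F}} => lead_coef p) biE.
rewrite !expr2 !lead_coefM lead_coefC lcDz -!expr2 => lcE.
have [b0|b0] := eqVneq (step_bi b) 0.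
  move: biE; rewrite b0 expr0n /= mulr0 => /eqP; rewrite expf_eq0 /= => /eqP /step_bi_eq0 a0.
  by move: ab0; rewrite a0 (step_bi_eq0 b0) eqxx.
apply: (@separable_not_square_ratio F D (lead_coef (step_bi a)) (lead_coef (step_bi b))
          (lead_coef D ^+ M) sepD sD).
- by rewrite lead_coef_eq0.
- by rewrite lcE -mul_polyC; ring.
- by rewrite expf_neq0 // lead_coef_eq0.
Qed.
End Stepanov.

(** Where [D] takes a square value, [G] vanishes, since there [G ^+ M] agrees with the polynomial
    that [step_kernel] makes zero. So at most [deg G], about [M ^ 2 / 2], such [y] exist, each
    carrying at most two [w]. *)
Lemma stepanov (F : finFieldType) (M e l : nat) (D : {poly F}) :
  #|F| = (M ^ 2)%N -> M = (2 * l + 2 * e + 3)%N -> (e ^ 2 + 3 * e + 2 <= l)%N ->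
  (0 < e)%N -> size D = (2 * e).+1 -> separable_poly D ->
  (\sum_(y : F) #|[set w : F | w ^+ 2 == D.[y]]| <= M ^ 2 + (4 * e + 4) * M)%N.
Proof.
move=> cardF EM el e0 sD sepD.
(* [2 * m * l] equals [l * M + l * (2 * e + 3)]; the surplus exceeds [m + 2 * e * h] exactly when
   [e ^ 2 + 3 * e + 2 <= l], which makes the count in [step_kernel] succeed. *)
pose h := (l + e + 2)%N; pose m := (l + 2 * e + 3)%N.
have hM : (2 * h = M.+1)%N by rewrite /h EM; lia.
have sW : (size (D ^+ h) <= (2 * e * h).+1)%N.
  by have := size_poly_exp_leq D h; rewrite sD /=.
have [|ab ab0 Edual] := @step_kernel F M cardF m l (D ^+ h) (2 * e * h)%N sW.
  by rewrite /m /h EM; nia.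
have sD1 : (1 < size D)%N by rewrite sD; lia.
have sDM : (2 * l + size D < M)%N by rewrite sD EM; lia.
have := step_nonzero cardF sepD sD1 hM sDM ab0; set G := _ + _ => G0.
have sG : (size G <= m * M + l + 2 * e * h)%N.
  apply: leq_trans (size_polyD _ _) _; rewrite geq_max.
  have H c := @size_step_poly F M cardF m l c.
  apply/andP; split; first by apply: leq_trans (H _) _; rewrite leq_addr.
  apply: leq_trans (size_polyMleq _ _) _.
  by have := H ab.2; move: sW; lia.
pose A := [set y : F | [exists w : F, w ^+ 2 == D.[y]]].
have rootG y : y \in A -> root G y.
  rewrite inE => /existsP[w /eqP Ew].
  suff : G.[y] ^+ M = 0 by move=> /eqP; rewrite expf_eq0 => /andP[_].
  have nM : [char F].-nat M by apply: finField_pnat cardF.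
  rewrite hornerD hornerM horner_exp exprDn_pchar // exprMn !step_poly_exp //.
  (* [D.[y] ^+ h] is [w ^+ M.+1], the norm of [w] to the subfield with [M] elements, hence fixed by
     the power [M]. *)
  have -> : D.[y] ^+ h ^+ M = D.[y] ^+ h.
    rewrite -Ew -(exprM w 2 h) hM -exprM mulSn mulnn -cardF exprD expf_card.
    by rewrite mulrC -exprS.
  by rewrite -horner_exp -hornerM -hornerD Edual horner0.
have cA : (#|A| < size G)%N.
  rewrite cardE; apply: max_poly_roots => //; last exact: enum_uniq.
  by apply/allP => y; rewrite mem_enum; apply: rootG.
apply: (@leq_trans (2 * #|A|)%N).
  rewrite (bigID (mem A)) /= [X in (_ + X)%N]big1 ?addn0 => [|y yA].
    rewrite -sum1_card big_distrr /=; apply: leq_sum => y _; rewrite muln1.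
    exact: card_sqrt_le2.
  apply/eqP; rewrite cards_eq0 -subset0; apply/subsetP => w; rewrite !inE => /eqP Ew.
  by move: yA; rewrite inE => /existsP[]; exists w; rewrite Ew.
have : (2 * (m * M + l + 2 * e * h) <= M ^ 2 + (4 * e + 4) * M)%N.
  by rewrite /m /h; rewrite EM; nia.
lia.
Qed.

(** * Additive characters and Kloosterman sums *)

Lemma sum_max_eq (T : finType) (f : T -> nat) c :
  (forall t, f t <= c)%N -> (\sum_t f t = c * #|T|)%N -> forall t, f t = c.
Proof.
move=> fc E t; apply/eqP; rewrite eqn_leq fc /= leqNgt; apply/negP => ft.
have : (\sum_t f t < \sum_(t : T) c)%N.
  rewrite (bigD1 t) //= [X in (_ < X)%N](bigD1 t) //= -addSn.
  by apply: leq_add => //; apply: leq_sum.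
by rewrite E sum_nat_const mulnC ltnn.
Qed.

Lemma sum_fiber_card (T U : finType) (f : T -> U) :
  (\sum_(u : U) #|[set x | f x == u]| = #|T|)%N.
Proof.
rewrite -sum1_card (partition_big f predT) //=.
by apply: eq_bigr => u _; rewrite -sum1_card; apply: eq_bigl => x; rewrite inE.
Qed.

Section SquareCount.
Variable F : finFieldType.
Implicit Types x y t g w : F.

Definition nonsquare g := forall x, x ^+ 2 != g.

Lemma odd_card_two_neq0 : odd #|F| -> 2%:R != 0 :> F.
Proof.
move=> oF; apply/negP => /eqP E2.
have c2 : 2%N \in [char F] by rewrite inE /= E2 eqxx.
have [n En] : exists n, #|F| = (2 ^ n)%N by exists (logn 2 #|F|); exact: (card_pprimeChar c2).
by move: oF (finNzRing_gt1 F); rewrite En; case: n {En} => // n; rewrite oddX.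
Qed.

Lemma nonsquare_exists : odd #|F| -> exists g, nonsquare g.
Proof.
move=> oF; have n2 := odd_card_two_neq0 oF.
pose f x := x ^+ 2.
have ninj : ~~ injectiveb f.
  apply/injectivePn; exists 1, (-1); last by rewrite /f sqrrN.
  by rewrite -subr_eq0 opprK.
have nsurj : ~~ [forall y, y \in codom f].
  apply: contra ninj => /forallP H; apply/injectiveP.
  have /image_injP inj : #|image f F| == #|F|.
    by apply/eqP/eq_card => y; rewrite H.
  by move=> x y; apply: inj.
move: nsurj; rewrite negb_forall => /existsP[g gf]; exists g => x.
by apply: contraNneq gf => <-; apply: codom_f.
Qed.

(* The two counts never add up to more than 2, and they sum to [2 * #|F|] over all [t]. *)
Lemma card_sqrt_twist g : nonsquare g ->
  forall t, (#|[set w : F | w ^+ 2 == t]| + #|[set w : F | (g * w ^+ 2)%R == t]|)%N = 2%N.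
Proof.
move=> gns; have g0 : g != 0 by rewrite eq_sym; have := gns 0; rewrite expr0n.
apply: sum_max_eq => [t|]; last first.
  by rewrite big_split /= !sum_fiber_card addnn mul2n.
have [A0|[x]] := set_0Vmem [set w : F | w ^+ 2 == t].
  rewrite A0 cards0 add0n.
  rewrite (_ : [set w | _] = [set w : F | w ^+ 2 == t / g]) ?card_sqrt_le2 //.
  by apply/setP => w; rewrite !inE mulrC -(inj_eq (mulIf g0) _ (t / g)) divfK.
rewrite inE => /eqP Ex.
have [x0|x0] := eqVneq x 0.
  have t0 : t = 0 by rewrite -Ex x0 expr0n.
  rewrite t0 (_ : [set w : F | g * w ^+ 2 == 0] = [set 0]).
    rewrite (_ : [set w : F | w ^+ 2 == 0] = [set 0]) ?cards1 //.
    by apply/setP => w; rewrite !inE expf_eq0.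
  by apply/setP => w; rewrite !inE mulf_eq0 (negbTE g0) expf_eq0.
rewrite [X in (_ + X)%N](_ : _ = 0%N) ?addn0 ?card_sqrt_le2 //.
apply/eqP; rewrite cards_eq0 -subset0; apply/subsetP => w; rewrite !inE => /eqP Ew.
have w0 : w != 0.
  by apply: contraNneq x0 => w0; move: Ew; rewrite w0 expr0n mulr0 -Ex => /esym/eqP; rewrite expf_eq0.
by have := gns (x / w); rewrite expr_div_n Ex -Ew mulfK ?expf_neq0 // eqxx.
Qed.

End SquareCount.

Definition addchar (F : finFieldType) (psi : F -> algC) :=
  [/\ psi 0 = 1, {morph psi : x y / x + y >-> x * y} & exists x, psi x != 1].

Section AddChar.
Variables (F : finFieldType) (psi : F -> algC).
Hypothesis psiP : addchar psi.

Let psi0 : psi 0 = 1. Proof. by case: psiP. Qed.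
Let psiD x y : psi (x + y) = psi x * psi y. Proof. by case: psiP. Qed.

(** [psi x] is a root of unity: its power by the characteristic [p] is [psi (x *+ p)], which is
    1. *)
Lemma addchar_norm x : `|psi x| = 1.
Proof.
have [p p_pr pF] := finPcharP F.
have psiM n : psi (x *+ n) = psi x ^+ n.
  by elim: n => [|n IH]; rewrite ?mulr0n ?psi0 ?expr0 // mulrS psiD IH exprS.
apply/eqP; rewrite -(@pexpr_eq1 _ _ p) ?prime_gt0 //.
by rewrite -normrX -psiM (mulrn_pchar pF) psi0 normr1.
Qed.

Lemma addchar_neq0 x : psi x != 0.
Proof. by rewrite -normr_gt0 addchar_norm ltr01. Qed.

Lemma addcharN x : psi (- x) = (psi x)^*.
Proof.
apply: (mulfI (addchar_neq0 x)).
by rewrite -psiD subrr psi0 -normCK addchar_norm expr1n.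
Qed.

Lemma sum_addchar : \sum_x psi x = 0.
Proof.
have [_ _ [z z1]] := psiP.
have E : \sum_x psi x = psi z * \sum_x psi x.
  rewrite mulr_sumr (reindex_inj (addrI z)); apply: eq_bigr => x _; exact: psiD.
move/eqP: E; rewrite -subr_eq0 -{1}[\sum_x _]mul1r -mulrBl mulf_eq0 subr_eq0.
by rewrite eq_sym (negbTE z1) => /eqP.
Qed.

Lemma sum_addchar_mul a : \sum_x psi (a * x) = if a == 0 then #|F|%:R else 0.
Proof.
case: eqVneq => [->|a0].
  rewrite (eq_bigr (fun=> 1)) => [|x _]; last by rewrite mul0r psi0.
  by rewrite sumr_const.
transitivity (\sum_x psi x); last exact: sum_addchar.
by rewrite [RHS](reindex_inj (mulfI a0)).
Qed.

End AddChar.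

(** Over the prime field, a coordinate form that is nonzero at 1 is composed with the powers of a
    primitive [p]-th root of unity. *)
Lemma addchar_exists (F : finFieldType) : exists psi : F -> algC, addchar psi.
Proof.
have [p p_pr pF] := finPcharP F.
pose V := pPrimeCharType pF.
have [z zP] := C_prim_root_exists (prime_gt0 p_pr).
pose co i (x : V) : 'F_p := coord (vbasis {:V}) i x.
have valD (a b : 'F_p) : (a + b)%R = ((a + b) %% p)%N :> nat.
  by congr (_ %% _)%N; rewrite Fp_cast.
case: (pickP (fun i => co i 1 != 0)) => [i i0|H]; last first.
  have /eqP[] := oner_neq0 V; rewrite (coord_vbasis (memvf (1 : V))) big1 // => i _.
  by have /negbFE/eqP := H i; rewrite /co => ->; rewrite scale0r.
exists (fun x : F => z ^+ (co i x)); split.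
- by rewrite /co linear0 expr0.
- move=> x y; rewrite /co (linearD (coord (vbasis {:V}) i) (x : V) y) valD.
  by rewrite (prim_expr_mod zP) exprD.
- exists 1; rewrite -(prim_order_dvd zP); apply: contra i0 => pd.
  rewrite -(inj_eq val_inj) /=; move: pd; rewrite /dvdn modn_small //.
  by rewrite -[X in (_ < X)%N](Fp_cast p_pr) ltn_ord.
Qed.

Definition nsqrt (F : finFieldType) (t : F) : nat := #|[set w : F | w ^+ 2 == t]|.

Lemma sumr_const_card (R : pzRingType) (T : finType) (x : R) :
  \sum_(t : T) x = #|T|%:R * x.
Proof. by rewrite sumr_const mulr_natl; congr (_ *+ _); apply: eq_card. Qed.

Definition kloosterman (F : finFieldType) (psi : F -> algC) (a : F) : algC :=
  \sum_(x | x != 0) psi (x + a / x).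

Lemma nsqrt_twist (F : finFieldType) (g t : F) :
  nonsquare g -> (nsqrt t + nsqrt (g * t)%R)%N = 2%N.
Proof.
move=> gns; have g0 : g != 0 by rewrite eq_sym; have := gns 0; rewrite expr0n.
rewrite -(card_sqrt_twist gns t); congr (_ + _)%N.
rewrite /nsqrt -(card_imset [set w : F | g * w ^+ 2 == t] (mulfI g0)).
apply: eq_card => w; rewrite inE; apply/eqP/imsetP => [Ew|[v]].
  exists (w / g); last by rewrite mulrC divfK.
  by rewrite inE expr_div_n Ew; apply/eqP; field.
by rewrite inE => /eqP <- ->; ring.
Qed.

(** The lower bound is the upper bound for the twist [g *: D], because the two counts add up to
    [2 * #|F|]. *)
Lemma stepanov_twosided (F : finFieldType) (M e l : nat) (D : {poly F}) :
  odd #|F| ->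
  #|F| = (M ^ 2)%N -> M = (2 * l + 2 * e + 3)%N -> (e ^ 2 + 3 * e + 2 <= l)%N ->
  (0 < e)%N -> size D = (2 * e).+1 -> separable_poly D ->
  `|(\sum_(y : F) nsqrt D.[y])%:R - #|F|%:R| <= ((4 * e + 4) * M)%:R :> algC.
Proof.
move=> oF cardF EM el e0 sD sepD.
have [g gns] := nonsquare_exists oF.
have g0 : g != 0 by rewrite eq_sym; have := gns 0; rewrite expr0n.
have H1 := stepanov cardF EM el e0 sD sepD.
have sgD : size (g *: D) = (2 * e).+1 by rewrite size_scale.
have sepgD : separable_poly (g *: D).
  by move: sepD; rewrite !unlock derivZ coprimepZl // coprimepZr.
have H2 := stepanov cardF EM el e0 sgD sepgD.
have H3 : (\sum_(y : F) nsqrt D.[y] + \sum_(y : F) nsqrt (g *: D).[y] = 2 * #|F|)%N.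
  rewrite -big_split /= (eq_bigr (fun=> 2%N)) => [|y _]; last by rewrite hornerZ nsqrt_twist.
  by rewrite sum_nat_const mulnC.
rewrite -/(nsqrt _) in H1 H2.
move: H1 H2 H3; rewrite -!cardF.
set s := (\sum_y _)%N; set s' := (\sum_y _)%N; set c := ((_ + _) * M)%N.
move=> H1 H2 H3; rewrite real_ler_norml ?rpredB ?realn // lerBlDr lerBrDr -natrD ler_nat addnC H1 andbT.
by rewrite addrC lerBlDr -natrD ler_nat; lia.
Qed.

Section KloostermanBound.
Variables (F : finFieldType) (psi : F -> algC) (a : F).
Hypotheses (psiP : addchar psi) (oF : odd #|F|) (a0 : a != 0).

Let n2 : 2%:R != 0 :> F. Proof. exact: odd_card_two_neq0. Qed.

(** [x + a / x = u] says that [x] is a root of [X^2 - u X + a], and [2 * x - u] is then a square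
    root of its discriminant. *)
Lemma kloosterman_nsqrt :
  kloosterman psi a = \sum_u psi u * (nsqrt (u ^+ 2 - 4 * a))%:R.
Proof.
rewrite /kloosterman (partition_big (fun x => x + a / x) predT) //=.
apply: eq_bigr => u _; rewrite (eq_bigr (fun=> psi u)) => [|x /andP[_ /eqP ->] //].
rewrite sumr_const mulr_natr; congr (_ *+ _).
have inj : injective (fun x : F => 2 * x - u) by move=> x y /addIr/(mulfI n2).
rewrite /nsqrt -(card_imset _ inj); apply: eq_card => w; rewrite inE.
apply/imsetP/eqP => [[x /andP[x0 /eqP <-] ->]|Ew]; first by field.
have n4 : 4%:R != 0 :> F by rewrite (_ : 4%:R = 2%:R * 2%:R) ?mulf_neq0 // -natrM.
have Ex : (w + u) / 2 * (u - (w + u) / 2) = a.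
  have -> : (w + u) / 2 * (u - (w + u) / 2) = (u ^+ 2 - w ^+ 2) / 4.
    by field; rewrite ?n4 ?n2.
  by rewrite Ew; field; rewrite ?n4.
exists ((w + u) / 2); last by field.
have x0 : (w + u) / 2 != 0.
  by apply: contraNneq a0 => E; rewrite -Ex E mul0r.
rewrite unfold_in x0 -[X in _ + X / _]Ex mulrAC divff // mul1r.
by rewrite /= addrC subrK.
Qed.

(* [psi] is invariant under the shifts [y^q - y], so the sum may be averaged over them. *)
Lemma kloosterman_frob_bound (M q l : nat) :
  #|F| = (M ^ 2)%N -> [char F].-nat q -> (1 < q)%N -> (forall y, psi (y ^+ q) = psi y) ->
  M = (2 * l + 2 * q + 3)%N -> (q ^ 2 + 3 * q + 2 <= l)%N ->
  `|kloosterman psi a| <= ((4 * q + 4) * M)%:R.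
Proof.
move=> cardF qF q1 psiq EM lq; have [p0 pD _] := psiP.
set B : algC := _%:R.
have F0 : (0 < #|F|%:R :> algC) by rewrite ltr0n; apply/card_gt0P; exists 0.
pose N u := (\sum_(y : F) nsqrt ((u + (y ^+ q - y)) ^+ 2 - 4 * a)%R)%N.
(* Subtracting [#|F|] from every [N u] is free because [psi] sums to zero; it brings in the point
   count errors, which are small. *)
have EK : #|F|%:R * kloosterman psi a = \sum_u psi u * ((N u)%:R - #|F|%:R).
  under [RHS]eq_bigr do rewrite mulrBr.
  rewrite sumrB -mulr_suml (sum_addchar psiP) mul0r subr0.
  under [RHS]eq_bigr do rewrite natr_sum mulr_sumr.
  rewrite exchange_big /= (eq_bigr (fun=> kloosterman psi a)); last first.
    move=> y _; rewrite kloosterman_nsqrt [RHS](reindex_inj (addIr (y ^+ q - y))) /=.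
    apply: eq_bigr => u _; congr (_ * _).
    by rewrite !pD psiq (addcharN psiP) -normCK addchar_norm // expr1n mulr1.
  by rewrite sumr_const_card.
have q0 : q%:R = 0 :> F.
  have [p p_pr pF] := finPcharP F.
  move: qF; rewrite (eq_pnat _ (pcharf_eq pF)) => /p_natP[[|k] Ek].
    by rewrite Ek in q1.
  by rewrite Ek natrX (pcharf0 pF) expr0n.
have NB u : `|(N u)%:R - #|F|%:R| <= B.
  pose L : {poly F} := 'X^q - 'X + u%:P.
  pose D : {poly F} := L ^+ 2 - (4 * a)%:P.
  have sL : size L = q.+1.
    rewrite /L -addrA size_polyDl size_polyXn //.
    apply: leq_ltn_trans (size_polyD _ _) _.
    by rewrite size_polyN size_polyX size_polyC gtn_max; case: (_ == _); lia.
  have sD : size D = (2 * q).+1.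
    have L0 : L != 0 by rewrite -size_poly_gt0 sL.
    have sL2 : size (L ^+ 2) = (2 * q).+1.
      by rewrite expr2 size_mul // sL; lia.
    rewrite /D size_polyDl sL2 // size_polyN size_polyC; case: (_ == _) => //=; lia.
  (* Since [q] vanishes in [F], the derivative of [L] is -1 and that of [D] is [-2 L]; as
     [D = L^2 - 4 a] with [a] nonzero, the two are coprime. *)
  have sepD : separable_poly D.
    have dL : L^`() = - 1.
      by rewrite /L derivD derivB derivXn derivX derivC addr0 -mulr_natr -polyC_natr q0 mulr0 sub0r.
    rewrite unlock /D derivB derivC subr0 expr2 derivM dL.
    have -> : -1 * L + L * -1 = (-2) *: L by rewrite -mul_polyC polyCN polyC_natr; ring.
    rewrite coprimepZr ?oppr_eq0 // coprimep_sym -polyCN coprimep_addl_mul.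
    apply/Bezout_coprimepP; exists (0, 1); rewrite mul0r add0r mul1r /=.
    rewrite -size_poly_eq1 size_polyC oppr_eq0 mulf_neq0 //.
    by rewrite (_ : 4%:R = 2%:R * 2%:R) ?mulf_neq0 // -natrM.
  have := stepanov_twosided oF cardF EM lq _ sD sepD.
  rewrite (_ : (\sum_y nsqrt D.[y])%N = N u); last first.
    apply: eq_bigr => y _; rewrite /D /L !hornerE; by congr (nsqrt (_ ^+ 2 - _)); rewrite /=; ring.
  by apply; lia.
rewrite -(ler_pM2l F0) -[X in X * `|_|](ger0_norm (ltW F0)) -normrM EK.
apply: le_trans (ler_norm_sum _ _ _) _.
rewrite -sumr_const_card; apply: ler_sum => u _.
by rewrite normrM addchar_norm // mul1r.
Qed.
End KloostermanBound.

(** * Weil's bound by descent from quadratic extensions *)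

Lemma quadratic_extension (F : finFieldType) : odd #|F| ->
  exists (L : finFieldType) (iota : {rmorphism F -> L}), #|L| = (#|F| ^ 2)%N.
Proof.
move=> oF; have [g gns] := nonsquare_exists oF.
pose h : {poly F} := 'X^2 - g%:P.
have sh : size h = 3%N by rewrite size_XnsubC.
have hI : monic_irreducible_poly h.
  split; last by rewrite monicXnsubC.
  apply: cubic_irreducible; first by rewrite sh.
  by move=> x; rewrite /root !hornerE subr_eq0 gns.
exists ({poly %/ h with hI} : finFieldType).
exists (qfpoly_const hI : {rmorphism F -> {poly %/ h with hI}}).
by rewrite card_qfpoly sh.
Qed.

Section QuadraticTrace.
Variables (F L : finFieldType) (iota : {rmorphism F -> L}).
Hypothesis cardL : #|L| = (#|F| ^ 2)%N.
Local Notation Q := #|F|.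

Let QL : [char L].-nat Q. Proof. exact: finField_pnat cardL. Qed.

Let frobK (z : L) : z ^+ Q ^+ Q = z.
Proof. by rewrite -exprM mulnn -cardL expf_card. Qed.

(** ['X^Q - 'X] has at most [Q] roots in [L], and the image of [F] already provides [Q] of them. *)
Lemma frob_fixed (z : L) : z ^+ Q = z -> exists x, iota x = z.
Proof.
move=> zQ; have Q1 : (1 < Q)%N := finNzRing_gt1 F.
have [/existsP[x /eqP <-]|/existsPn nz] := boolP [exists x, iota x == z]; first by exists x.
pose p : {poly L} := 'X^Q - 'X.
have sp : size p = Q.+1.
  by rewrite /p size_polyDl size_polyXn // size_polyN size_polyX ltnS.
have p0 : p != 0 by rewrite -size_poly_gt0 sp.
have := @max_poly_roots _ p (z :: map iota (enum F)) p0.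
rewrite /= size_map -cardE sp ltnn => H; suff : false by []; apply: H.
  rewrite /root /p !hornerE zQ subrr eqxx /=; apply/allP => _ /mapP[x _ ->].
  by rewrite /root !hornerE -rmorphXn expf_card subrr.
rewrite (map_inj_uniq (fmorph_inj iota)) enum_uniq andbT.
by apply/mapP => -[x _ E]; have := nz x; rewrite E eqxx.
Qed.

(** [qtr] and [qnm] are trace and norm of [L] over [F], pulled back along [iota]. The search for a
    preimage always succeeds, as both values are fixed by the power [Q]. *)
Definition qtr (z : L) : F := odflt 0 [pick x | iota x == z + z ^+ Q].
Definition qnm (z : L) : F := odflt 0 [pick x | iota x == z * z ^+ Q].

Lemma qtrE z : iota (qtr z) = z + z ^+ Q.
Proof.
rewrite /qtr; case: pickP => [x /eqP //|H].
have [|x Ex] := @frob_fixed (z + z ^+ Q); last by have := H x; rewrite Ex eqxx.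
by rewrite exprDn_pchar // frobK addrC.
Qed.

Lemma qnmE z : iota (qnm z) = z * z ^+ Q.
Proof.
rewrite /qnm; case: pickP => [x /eqP //|H].
have [|x Ex] := @frob_fixed (z * z ^+ Q); last by have := H x; rewrite Ex eqxx.
by rewrite exprMn frobK mulrC.
Qed.

Lemma qtr_iota x : qtr (iota x) = 2 * x.
Proof.
apply: (fmorph_inj iota); rewrite qtrE -rmorphXn expf_card rmorphM rmorph_nat.
by rewrite mulr_natl mulr2n.
Qed.

(* The left count is that of the roots of [X^2 - T X + N] in [F], the right one that of its
   conjugate roots in [L]: again the total never exceeds 2 and is 2 on average. *)
Lemma qtr_qnm_card (T N : F) :
  (#|[set p : F * F | (p.1 + p.2, p.1 * p.2)%R == (T, N)]|
   + #|[set z : L | (qtr z, qnm z) == (T, N)]| = 2)%N.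
Proof.
pose f (p : F * F) := (p.1 + p.2, p.1 * p.2); pose g z := (qtr z, qnm z).
apply: (@sum_max_eq _ (fun t : F * F => #|[set p | f p == t]| + #|[set z | g z == t]|)%N _ _ _ (T, N)); last first.
  by rewrite big_split /= !sum_fiber_card card_prod cardL mulnn addnn mul2n.
case=> {}T {}N.
have charZ z : g z = (T, N) -> forall w, g w = (T, N) -> (w - z) * (w - z ^+ Q) = 0.
  move=> [zT zN] w [wT wN].
  have E : w * w ^+ Q - (w + w ^+ Q) * w + w ^+ 2 = 0 by ring.
  by rewrite -E -qtrE -qnmE wT wN -zT -zN qtrE qnmE; ring.
have [A0|[[x y]]] := set_0Vmem [set p | f p == (T, N)].
  rewrite A0 cards0 add0n.
  have [->|[z]] := set_0Vmem [set z | g z == (T, N)]; first by rewrite cards0.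
  rewrite inE => /eqP zE; apply: (@leq_trans #|[set z; z ^+ Q]|); last by rewrite cards2; case: (_ == _).
  apply/subset_leq_card/subsetP => w; rewrite !inE => /eqP /(charZ z zE)/eqP.
  by rewrite mulf_eq0 !subr_eq0.
rewrite inE => /eqP [ExT ExN].
have sA : [set p | f p == (T, N)] \subset [set (x, y); (y, x)].
  apply/subsetP => -[u v]; rewrite !inE => /eqP [EuT EuN].
  have : (u - x) * (u - y) = 0.
    have -> : (u - x) * (u - y) = u ^+ 2 - (x + y) * u + x * y by ring.
    by rewrite ExT ExN -EuT -EuN; ring.
  move/eqP; rewrite mulf_eq0 !subr_eq0 !xpair_eqE => /orP[]/eqP Eu; apply/orP; [left|right];
  rewrite Eu eqxx /=; apply/eqP; move: EuT; rewrite -ExT Eu; first exact: addrI.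
  by rewrite [x + y]addrC; apply: addrI.
(* A pair in [F] and an element of [L] with the same invariants are roots of one quadratic
   polynomial; this forces a double root, and then each count is at most one. *)
have sB z : g z = (T, N) -> x = y /\ z = iota x.
  case=> zT zN.
  have : (z - iota x) * (z - iota y) = 0.
    have -> : (z - iota x) * (z - iota y) = z ^+ 2 - iota (x + y) * z + iota (x * y).
      by rewrite rmorphD rmorphM; ring.
    by rewrite ExT ExN -zT -zN qtrE qnmE; ring.
  have tx : qtr z = x + y by rewrite zT ExT.
  move/eqP; rewrite mulf_eq0 !subr_eq0 => /orP[]/eqP Ez.
    have E : x = y by apply: (addrI x); rewrite -tx Ez qtr_iota; ring.
    by split.
  have E : x = y by apply: (addIr y); rewrite -tx Ez qtr_iota; ring.
  by rewrite E; split.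
have [xy|xy] := eqVneq x y.
  apply: (@leq_trans (1 + 1)%N) => //; apply: leq_add.
    apply: leq_trans (subset_leq_card sA) _; rewrite xy setUid cards1 //.
  apply: (@leq_trans #|[set iota x]|); last by rewrite cards1.
  by apply/subset_leq_card/subsetP => z; rewrite !inE => /eqP/sB[_ ->].
rewrite [X in (_ + X)%N](_ : _ = 0%N) ?addn0.
  by apply: leq_trans (subset_leq_card sA) _; rewrite cards2; case: (_ == _).
apply/eqP; rewrite cards_eq0 -subset0; apply/subsetP => z; rewrite !inE => /eqP/sB[E _].
by rewrite E eqxx in xy.
Qed.

Lemma qtrD z w : qtr (z + w) = qtr z + qtr w.
Proof.
apply: (fmorph_inj iota); rewrite rmorphD !qtrE exprDn_pchar //; ring.
Qed.

Lemma qtr_addchar (psi : F -> algC) : odd Q -> addchar psi -> addchar (psi \o qtr).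
Proof.
move=> oF [p0 pD [x px]]; have n2 := odd_card_two_neq0 oF; split=> /=.
- by rewrite -(rmorph0 iota) qtr_iota mulr0.
- by move=> z w /=; rewrite qtrD pD.
- by exists (iota (x / 2)); rewrite /= qtr_iota mulrC divfK.
Qed.

(** Both the sum over [L] and the square of the sum over [F] become sums of [psi (T + a * T / N)]
    when grouped by trace and norm, respectively by sum and product. The multiplicities add up to 2
    by [qtr_qnm_card], and in the total only [N = - a] survives the summation over [T]. *)
Lemma kloosterman_quadratic (psi : F -> algC) (a : F) :
  addchar psi -> a != 0 ->
  kloosterman (psi \o qtr) (iota a) = 2 * #|F|%:R - kloosterman psi a ^+ 2.
Proof.
move=> psiP a0; have [p0 pD _] := psiP.
pose f (p : F * F) := (p.1 + p.2, p.1 * p.2); pose g z := (qtr z, qnm z).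
pose w (t : F * F) := psi (t.1 + a * t.1 / t.2).
have nm0 z : (qnm z == 0) = (z == 0).
  by rewrite -(fmorph_eq0 iota) qnmE mulf_eq0 expf_eq0; case: (z == 0) => //=; rewrite andbF.
have E1 : kloosterman (psi \o qtr) (iota a) =
    \sum_(t : F * F | t.2 != 0) w t * (#|[set z | g z == t]|)%:R.
  rewrite /kloosterman (partition_big g (fun t => t.2 != 0)) /=; last by move=> z; rewrite nm0.
  apply: eq_bigr => t t0; rewrite (eq_bigr (fun=> w t)) => [|z /andP[z0 /eqP <-]].
    rewrite sumr_const mulr_natr; congr (_ *+ _); apply: eq_card => z.
    rewrite inE unfold_in /= -nm0; case: (g z =P t) => [E|_]; rewrite ?andbF //= andbT.
    by move: t0; rewrite -E.
  congr psi; apply: (fmorph_inj iota).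
  rewrite rmorphD rmorphM fmorphV rmorphM !qtrE !qnmE.
  have zQ0 : z ^+ Q != 0 by rewrite expf_neq0.
  rewrite exprDn_pchar // exprMn exprVn -rmorphXn expf_card.
  by field; rewrite z0 zQ0.
have E2 : kloosterman psi a ^+ 2 =
    \sum_(t : F * F | t.2 != 0) w t * (#|[set p | f p == t]|)%:R.
  rewrite expr2 /kloosterman big_distrlr pair_big /=.
  rewrite (partition_big f (fun t => t.2 != 0)) /=; last first.
    by move=> [x y] /= /andP[x0 y0]; rewrite mulf_neq0.
  apply: eq_bigr => t t0; rewrite (eq_bigr (fun=> w t)) => [|[x y] /= /andP[/andP[x0 y0] /eqP <-]].
    rewrite sumr_const mulr_natr; congr (_ *+ _); apply: eq_card => -[x y].
    rewrite inE unfold_in /=; case: (f (x, y) =P t) => [E|_]; rewrite ?andbF //= andbT.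
    by move: t0; rewrite -E /= mulf_eq0 negb_or.
  by rewrite -pD; congr psi => /=; field; rewrite x0 y0.
rewrite E1 E2; apply/eqP; rewrite eq_sym subr_eq; apply/eqP.
rewrite -big_split /= (eq_bigr (fun t => w t * 2)); last first.
  by move=> [T N] _; rewrite -mulrDr -natrD addnC qtr_qnm_card.
rewrite -mulr_suml mulrC; congr (_ * _).
rewrite -(pair_big_dep predT (fun T N => N != 0) (fun T N => w (T, N))) /= exchange_big /=.
rewrite (bigD1 (- a)) ?oppr_eq0 //= [X in _ + X]big1 ?addr0.
  rewrite (eq_bigr (fun=> 1)) ?sumr_const_card ?mulr1 // => T _; rewrite /w /=.
  by rewrite -p0; congr psi; field; rewrite oppr_eq0.
move=> N /andP[N0 Na].
rewrite (eq_bigr (fun T => psi ((1 + a / N) * T))) => [|T _]; last first.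
  by rewrite /w; congr psi => /=; ring.
rewrite (sum_addchar_mul psiP); case: eqP => // E.
have Ea : N + a = N * (1 + a / N) by field.
by move: Na; rewrite -addr_eq0 Ea E mulr0 eqxx.
Qed.

End QuadraticTrace.

Lemma kloosterman_real (F : finFieldType) (psi : F -> algC) a :
  addchar psi -> kloosterman psi a \is Num.real.
Proof.
move=> psiP; rewrite CrealE /kloosterman rmorph_sum /=.
rewrite [X in _ == X](reindex_inj oppr_inj) /=; apply/eqP/eq_big => [x|x x0].
  by rewrite oppr_eq0.
by rewrite -(addcharN psiP); congr psi; rewrite invrN; ring.
Qed.

(** One extension multiplies the excess by at least 4: if [K ^+ 2] is at least [(4 + e) * Q], then
    [K ^+ 2 - 2 * Q] is at least [(2 + e) * Q], whose square is at least [(4 + 4 * e) * Q ^+ 2]. The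
    invariance of [chi] under the power [#|F|] of the bottom field is kept so that the averaging
    curves have the same degree on every level. *)
Lemma kloosterman_tower (F : finFieldType) (psi : F -> algC) (a : F) (eps : algC) k :
  addchar psi -> odd #|F| -> a != 0 -> 0 <= eps ->
  (4 + eps) * #|F|%:R <= kloosterman psi a ^+ 2 ->
  exists (L : finFieldType) (chi : L -> algC) (b : L),
    [/\ addchar chi, #|L| = (#|F| ^ (2 ^ k))%N, b != 0,
        forall y, chi (y ^+ #|F|) = chi y
      & (4 + 4 ^+ k * eps) * #|L|%:R <= kloosterman chi b ^+ 2].
Proof.
move=> psiP oF a0 eps0 Hk; elim: k => [|k [L [chi [b [chiP cL b0 chiF H]]]]].
  exists F, psi, a; split=> //; first by move=> y; rewrite expf_card.
  by rewrite expr0 mul1r.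
have oL : odd #|L| by rewrite cL oddX oF orbT.
have [L' [iota cL']] := quadratic_extension oL.
exists L', (chi \o qtr iota), (iota b); split.
- exact: qtr_addchar.
- by rewrite cL' cL -expnM -expnSr.
- by rewrite fmorph_eq0.
- move=> y /=; rewrite -[RHS]chiF; congr chi; apply: (fmorph_inj iota).
  have FL : [char L'].-nat #|F|.
    by apply: (@finField_pnat L' _ (2 ^ k.+1)); rewrite ?expn_gt0 // cL' cL -expnM -expnSr.
  rewrite rmorphXn !qtrE // exprDn_pchar //.
  by rewrite -!exprM mulnC.
rewrite kloosterman_quadratic // cL' natrX.
set K := kloosterman chi b in H *; set Q : algC := #|L|%:R in H *.
have KR : K ^+ 2 \is Num.real by rewrite rpredX // kloosterman_real.
have Q0 : 0 <= Q by rewrite ler0n.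
set e := 4 ^+ k * eps in H *; have e0 : 0 <= e by rewrite mulr_ge0 // exprn_ge0.
apply: (@le_trans _ _ (((2 + e) * Q) ^+ 2)).
  rewrite exprMn ler_wpM2r ?exprn_ge0 // exprS -mulrA -/e.
  rewrite (_ : (2 + e) ^+ 2 = 4 + 4 * e + e ^+ 2) ?lerDl ?exprn_ge0 //; ring.
have le1 : (2 + e) * Q <= K ^+ 2 - 2 * Q.
  by rewrite lerBrDr -mulrDl (le_trans _ H) // (_ : 2 + e + 2 = 4 + e) //; ring.
have ge0 : 0 <= (2 + e) * Q by rewrite mulr_ge0 // addr_ge0.
by rewrite -[X in _ <= X]sqrrN opprB ler_pXn2r ?nnegrE // (le_trans ge0).
Qed.

Lemma pow4_unbounded (eps B : algC) :
  0 < eps -> 0 <= B -> exists k0, forall k, (k0 <= k)%N -> B < 4 ^+ k * eps.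
Proof.
move=> eps0 B0; have Be0 : 0 <= B / eps by rewrite divr_ge0 // ltW.
have H := archi_boundP Be0; exists (Num.bound (B / eps)) => k hk.
rewrite -ltr_pdivrMr // (lt_le_trans H) // -natrX ler_nat.
by apply: leq_trans hk _; apply: ltnW; apply: ltn_expl.
Qed.

Lemma stepanov_params (M q : nat) : (1 < q)%N -> (q ^ 8 <= M)%N -> odd M ->
  exists2 l, M = (2 * l + 2 * q + 3)%N & (q ^ 2 + 3 * q + 2 <= l)%N.
Proof.
move=> q1 qM oM.
have q2 : (1 * q <= q ^ 2)%N by rewrite -mulnn leq_mul2r ltnW ?orbT.
have big : (64 * q ^ 2 <= M)%N.
  apply: leq_trans qM; rewrite (expnD q 6 2) leq_mul2r; apply/orP; right.
  by rewrite (@leq_exp2r 2 q 6).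
have q22 : (4 <= q ^ 2)%N by rewrite (@leq_exp2r 2 q 2).
exists ((M - 2 * q - 3)./2)%N; move: (q ^ 2)%N (q ^ 8)%N q2 big q22 qM oM => x y; lia.
Qed.

Theorem kloosterman_weil (F : finFieldType) (psi : F -> algC) (a : F) :
  addchar psi -> odd #|F| -> a != 0 -> `|kloosterman psi a| ^+ 2 <= 4 * #|F|%:R.
Proof.
move=> psiP oF a0; set q := #|F|.
have KR := kloosterman_real a psiP.
rewrite -normrX ger0_norm ?real_exprn_even_ge0 //.
have R2 : kloosterman psi a ^+ 2 \is Num.real by rewrite rpredX.
have R4 : (4 * q%:R : algC) \is Num.real by rewrite rpredM // realn.
case: (real_leP R2 R4) => // lt4; exfalso.
have q1 : (1 < q)%N := finNzRing_gt1 F.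
have q0 : 0 < q%:R :> algC by rewrite ltr0n; lia.
pose eps := (kloosterman psi a ^+ 2 - 4 * q%:R) / q%:R.
have eps0 : 0 < eps by rewrite divr_gt0 // subr_gt0.
pose B := (4 * q + 4)%:R ^+ 2 : algC.
have B0 : 0 <= B by rewrite exprn_ge0.
have [k0 Hk0] := pow4_unbounded eps0 B0.
(* [k0] pushes the excess beyond the square of the constant in [kloosterman_frob_bound]; the extra 3
   gives [q ^ 8 <= M]. *)
pose k := (k0 + 3)%N.
have [|L [chi [b [chiP cL b0 chiF H]]]] := @kloosterman_tower F psi a eps k.+1 psiP oF a0 (ltW eps0).
  by rewrite mulrDl divfK ?gt_eqF // addrC subrK.
pose M := (q ^ (2 ^ k))%N.
have cLM : #|L| = (M ^ 2)%N by rewrite cL /M -expnM -expnSr.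
have oL : odd #|L| by rewrite cL oddX oF orbT.
have oM : odd M by rewrite /M oddX oF orbT.
have bigM : (q ^ 8 <= M)%N.
  rewrite leq_exp2l // (leq_pexp2l (m := 2) (n1 := 3)) // /k leq_addl //.
have [l EM Hl] := stepanov_params q1 bigM oM.
have qL : [char L].-nat q by apply: (@finField_pnat L _ (2 ^ k.+1)); rewrite ?expn_gt0.
have := kloosterman_frob_bound chiP oL b0 cLM qL q1 chiF EM Hl.
have Lk : B < 4 ^+ k.+1 * eps by apply: Hk0; rewrite /k -addnS leq_addr.
rewrite -(@ler_pXn2r _ 2) ?nnegrE // natrM exprMn -/B -normrX.
rewrite ger0_norm ?real_exprn_even_ge0 ?kloosterman_real //.
move=> H2; have := le_trans H H2; rewrite cLM natrX ler_pM2r; last first.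
  by rewrite exprn_gt0 // ltr0n expn_gt0 ltnW.
move=> H3; suff H4 : 4 ^+ k.+1 * eps <= B by have := lt_le_trans Lk H4; rewrite ltxx.
by apply: le_trans H3; rewrite lerDr.
Qed.

(** * Fourier coefficients of conics *)

Section Gauss.
Variables (F : finFieldType) (psi : F -> algC).
Hypotheses (psiP : addchar psi) (oF : odd #|F|).
Implicit Types a b c j : F.

Let n2 : 2%:R != 0 :> F. Proof. exact: odd_card_two_neq0. Qed.
Let psi0 : psi 0 = 1. Proof. by case: psiP. Qed.
Let psiD x y : psi (x + y) = psi x * psi y. Proof. by case: psiP. Qed.

Definition gauss a : algC := \sum_x psi (a * x ^+ 2).

Lemma gauss_norm a : a != 0 -> `|gauss a| ^+ 2 = #|F|%:R.
Proof.
move=> a0; rewrite normCK /gauss rmorph_sum big_distrlr /= exchange_big /=.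
transitivity (\sum_y \sum_t psi (a * t ^+ 2) * psi (2 * a * t * y)).
  apply: eq_bigr => y _; rewrite (reindex_inj (addIr y)) /=.
  apply: eq_bigr => t _; rewrite -(addcharN psiP) -!psiD; congr psi; ring.
rewrite exchange_big /= (bigD1 0) //= [X in _ + X]big1 ?addr0 => [|t t0].
  rewrite (eq_bigr (fun=> 1)) ?sumr_const_card ?mulr1 // => y _.
  by rewrite expr0n !mulr0 mul0r psi0 mulr1.
by rewrite -mulr_sumr (sum_addchar_mul psiP) !mulf_eq0 (negbTE n2) (negbTE a0) (negbTE t0) mulr0.
Qed.

(** Squares and [j] times squares together hit every [t] exactly twice, so the two Gauss sums add up
    to a full character sum. *)
Lemma gauss_nonsquare j a : nonsquare j -> a != 0 -> gauss (j * a) = - gauss a.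
Proof.
move=> jns a0; apply/eqP; rewrite -addr_eq0; apply/eqP.
have H (h : F -> F) : \sum_x psi (a * h x) =
    \sum_t psi (a * t) * (#|[set x | h x == t]|)%:R.
  rewrite (partition_big h predT) //=; apply: eq_bigr => t _.
  rewrite (eq_bigr (fun=> psi (a * t))) => [|x /eqP -> //].
  by rewrite sumr_const mulr_natr; congr (_ *+ _); apply: eq_card => x; rewrite inE.
have -> : gauss (j * a) = \sum_x psi (a * (j * x ^+ 2)).
  by apply: eq_bigr => x _; congr psi; ring.
rewrite /gauss !H -big_split /= (eq_bigr (fun t => psi (a * t) * 2)).
  by rewrite -mulr_suml (sum_addchar_mul psiP) (negbTE a0) mul0r.
by move=> t _; rewrite -mulrDr -natrD addnC (card_sqrt_twist jns).
Qed.

(** Scaling by [j] changes both factors by the same sign. This makes the constant in [gauss_binary]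
    independent of [j]. *)
Lemma gauss_mul j a b : j != 0 -> a != 0 -> b != 0 ->
  gauss (j * a) * gauss (j * b) = gauss a * gauss b.
Proof.
move=> j0 a0 b0; have [/existsP[s /eqP Es]|/existsPn jns] := boolP [exists s : F, s ^+ 2 == j].
  have s0 : s != 0 by apply: contraNneq j0 => s0; rewrite -Es s0 expr0n.
  have H c : gauss (j * c) = gauss c.
    rewrite /gauss [RHS](reindex_inj (mulfI s0)) /=.
    by apply: eq_bigr => x _; congr psi; rewrite -Es; ring.
  by rewrite !H.
by rewrite !gauss_nonsquare // mulrNN.
Qed.

Lemma gauss_linear a b : a != 0 ->
  \sum_x psi (a * x ^+ 2 + b * x) = gauss a * psi (- (b ^+ 2) / (4 * a)).
Proof.
move=> a0; have n4 : 4%:R != 0 :> F by rewrite (_ : 4%:R = 2%:R * 2%:R) ?mulf_neq0 // -natrM.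
rewrite /gauss mulr_suml [RHS](reindex_inj (addIr (b / (2 * a)))) /=.
apply: eq_bigr => x _; rewrite -psiD; congr psi; field.
by rewrite a0 ?n4 ?n2.
Qed.

(** Completing squares turns the form into its dual. That one [e] serves all [j] is what later
    leaves a Kloosterman sum, without quadratic twist, in the summation over [j]. *)
Lemma gauss_binary (A B C : F) : 4 * A * C - B ^+ 2 != 0 ->
  exists2 e : algC, `|e| = #|F|%:R & forall u v j, j != 0 ->
    \sum_x \sum_y psi (j * (A * x ^+ 2 + B * x * y + C * y ^+ 2) + u * x + v * y)
    = e * psi (- (C * u ^+ 2 - B * u * v + A * v ^+ 2) / (4 * A * C - B ^+ 2) / j).
Proof.
set Dl := 4 * A * C - B ^+ 2 => Dl0.
have n4 : 4%:R != 0 :> F by rewrite (_ : 4%:R = 2%:R * 2%:R) ?mulf_neq0 // -natrM.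
(* For [A = 0] the exponent is linear in [x], so the sum over [x] selects the single value [y0] of
   [y]. *)
have [A0|A0] := eqVneq A 0.
  have B0 : B != 0 by apply: contraNneq Dl0 => B0; rewrite /Dl A0 B0; apply/eqP; ring.
  exists #|F|%:R; first by rewrite ger0_norm.
  move=> u v j j0; rewrite exchange_big /=.
  pose y0 := - u / (j * B).
  rewrite (bigD1 y0) //= [X in _ + X]big1 ?addr0 => [|y yy0].
    rewrite -sumr_const_card; apply: eq_bigr => x _; congr psi.
    by rewrite /y0 /Dl A0; field; rewrite B0 j0 ?oppr_eq0 ?mulf_neq0.
  rewrite (eq_bigr (fun x => psi (j * C * y ^+ 2 + v * y) * psi ((j * B * y + u) * x))).
    rewrite -mulr_sumr (sum_addchar_mul psiP); case: eqP => [E|]; last by rewrite mulr0.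
    case/eqP: yy0; rewrite /y0; apply: (mulfI (mulf_neq0 j0 B0)).
    have -> : j * B * y = - u by apply/eqP; rewrite -addr_eq0 E.
    by rewrite mulrC divfK // mulf_neq0.
  by move=> x _; rewrite -psiD A0; congr psi; ring.
(* [T] is the coefficient of [y ^+ 2] after the square in [x] is completed. *)
pose T := C - B ^+ 2 / (4 * A).
have DlT : Dl = 4 * A * T by rewrite /Dl /T; field; rewrite A0 n4.
have T0 : T != 0 by apply: contraNneq Dl0 => T0; rewrite DlT T0 mulr0.
exists (gauss A * gauss T).
  apply/eqP; rewrite -(@eqrXn2 _ 2) // normrM exprMn !gauss_norm // -expr2 eqxx //.
move=> u v j j0; rewrite exchange_big /=.
transitivity (\sum_y gauss (j * A) * psi (- u ^+ 2 / (4 * A * j)) *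
      psi (j * T * y ^+ 2 + (v - B * u / (2 * A)) * y)).
  apply: eq_bigr => y _.
  transitivity (psi (j * C * y ^+ 2 + v * y) * \sum_x psi (j * A * x ^+ 2 + (j * B * y + u) * x)).
    by rewrite mulr_sumr; apply: eq_bigr => x _; rewrite -psiD; congr psi; ring.
  rewrite gauss_linear ?mulf_neq0 // mulrCA -[RHS]mulrA -!psiD; congr (_ * psi _).
  by rewrite /T; field; rewrite ?j0 ?A0 ?n2 ?n4.
rewrite -mulr_sumr gauss_linear ?mulf_neq0 // -(gauss_mul j0 A0 T0).
rewrite [LHS](_ : _ = gauss (j * A) * gauss (j * T) *
  (psi (- u ^+ 2 / (4 * A * j)) * psi (- (v - B * u / (2 * A)) ^+ 2 / (4 * (j * T))))); last by ring.
rewrite -psiD; congr (_ * psi _); rewrite DlT.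
have -> : C = T + B ^+ 2 / (4 * A) by rewrite /T subrK.
by field; rewrite ?j0 ?A0 ?T0 ?n2 ?n4.
Qed.

End Gauss.

Definition rv (K : finFieldType) (x y : K) : 'rV[K]_2 :=
  \row_(i < 2) (if i == 0 then x else y).

Lemma rv0 (K : finFieldType) (x y : K) : rv x y 0 0 = x. Proof. by rewrite mxE. Qed.
Lemma rv1 (K : finFieldType) (x y : K) : rv x y 0 1 = y. Proof. by rewrite mxE. Qed.

Lemma rowP2 (K : finFieldType) (u v : 'rV[K]_2) : u 0 0 = v 0 0 -> u 0 1 = v 0 1 -> u = v.
Proof.
move=> E0 E1; apply/rowP => i; case: (unliftP 0 i) => [j ->|-> //].
by rewrite (_ : lift 0 j = 1) //; apply/val_inj; rewrite /= ord1.
Qed.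

Lemma rvK (K : finFieldType) (v : 'rV[K]_2) : rv (v 0 0) (v 0 1) = v.
Proof. by apply: rowP2; rewrite ?rv0 ?rv1. Qed.

Lemma sum_rV2 (K : finFieldType) (R : nmodType) (G : 'rV[K]_2 -> R) :
  \sum_v G v = \sum_x \sum_y G (rv x y).
Proof.
rewrite pair_bigA /= (reindex (fun p : K * K => rv p.1 p.2)) //=.
exists (fun v : 'rV[K]_2 => (v 0 0, v 0 1)) => [[x y]|v] _ /=; first by rewrite rv0 rv1.
exact: rvK.
Qed.

Definition dot (K : finFieldType) (u v : 'rV[K]_2) : K := u 0 0 * v 0 0 + u 0 1 * v 0 1.

Lemma dotDr (K : finFieldType) (u v w : 'rV[K]_2) : dot u (v + w) = dot u v + dot u w.
Proof. by rewrite /dot !mxE; ring. Qed.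

Lemma dotNr (K : finFieldType) (u v : 'rV[K]_2) : dot u (- v) = - dot u v.
Proof. by rewrite /dot !mxE; ring. Qed.

Lemma dotC (K : finFieldType) (u v : 'rV[K]_2) : dot u v = dot v u.
Proof. by rewrite /dot; ring. Qed.

Section Spectral.
Variables (K : finFieldType) (psi : K -> algC).
Hypotheses (psiP : addchar psi) (oK : odd #|K|).
Implicit Types (S : {set 'rV[K]_2}) (xi v : 'rV[K]_2).
Local Notation q := #|K|.

Let psi0 : psi 0 = 1. Proof. by case: psiP. Qed.
Let psiD x y : psi (x + y) = psi x * psi y. Proof. by case: psiP. Qed.

Definition ft S xi : algC := \sum_(v in S) psi (dot xi v).

(** All that the combinatorial part asks of a conic's Fourier coefficients and size: the bound
    [2 sqrt q], squared to avoid roots, and a cardinality within one of [q]. *)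
Definition spectral S :=
  [/\ forall xi, xi != 0 -> `|ft S xi| ^+ 2 <= 4 * q%:R,
      (q <= #|S|.+1)%N & (#|S| <= q.+1)%N].

Lemma sum_dot v : \sum_xi psi (dot xi v) = if v == 0 then (q ^ 2)%:R else 0.
Proof.
rewrite sum_rV2.
under eq_bigr do under eq_bigr do rewrite /dot rv0 rv1 psiD ![_ * v _ _]mulrC.
under eq_bigr do rewrite -mulr_sumr (sum_addchar_mul psiP).
rewrite -mulr_suml (sum_addchar_mul psiP).
have -> : (v == 0) = (v 0 0 == 0) && (v 0 1 == 0).
  apply/eqP/andP => [->|[/eqP v0 /eqP v1]]; first by rewrite !mxE eqxx.
  by apply: rowP2; rewrite mxE.
by do 2!case: eqP => _; rewrite /= ?mulr0 ?mul0r // -natrM mulnn.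
Qed.

Lemma ft_translate S t xi : ft [set z + t | z in S] xi = psi (dot xi t) * ft S xi.
Proof.
rewrite /ft big_imset /=; last by move=> x y _ _; apply: addIr.
by rewrite mulr_sumr; apply: eq_bigr => v _; rewrite dotDr psiD mulrC.
Qed.

Lemma spectral_translate S t : spectral S -> spectral [set z + t | z in S].
Proof.
move=> [H1 H2 H3]; split; rewrite ?card_imset //; try exact: addIr.
by move=> xi /H1; rewrite ft_translate normrM (addchar_norm psiP) mul1r.
Qed.

(** For [c = 0] the sum is a full character sum without its term at 0, hence -1; otherwise rescaling
    [j] by [F0] gives a Kloosterman sum. *)
Lemma sum_kloosterman F0 : F0 != 0 -> forall c,
  `|\sum_(j | j != 0) psi (j * F0 + c / j)| ^+ 2 <= 4 * q%:R.
Proof.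
move=> F00 c; have [->|c0] := eqVneq c 0.
  rewrite (eq_bigr (fun j => psi (F0 * j))) => [|j _]; last by congr psi; ring.
  have := sum_addchar_mul psiP F0; rewrite (negbTE F00) (bigD1 0) //= mulr0 psi0.
  move/eqP; rewrite addrC addr_eq0 => /eqP ->; rewrite normrN1 expr1n -natrM.
  by rewrite ler1n muln_gt0 /=; apply/card_gt0P; exists 0.
rewrite (_ : \sum_(j | _) _ = kloosterman psi (c * F0)).
  by apply: kloosterman_weil => //; rewrite mulf_neq0.
rewrite /kloosterman [RHS](reindex_inj (mulIf F00)) /=.
apply: eq_big => [j|j j0]; first by rewrite mulf_eq0 negb_or F00 andbT.
by congr psi; field; rewrite j0 F00.
Qed.

(** The equation is detected by averaging [psi (j * f v)] over [j]. The term [j = 0] is supported at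
    [xi = 0]; the others are evaluated by [gauss_binary] and leave [e] times a Kloosterman sum. At
    [xi = 0] that sum is -1, which gives the cardinality. *)
Lemma conic_spectral (A B C F0 : K) :
  F0 != 0 -> 4 * A * C - B ^+ 2 != 0 -> spectral (conic_zeros A B C 0 0 F0).
Proof.
move=> F00 Dl0; have [e e1 He] := gauss_binary psiP oK Dl0.
set Z := conic_zeros _ _ _ _ _ _.
have q0 : 0 < q%:R :> algC by rewrite ltr0n; apply/card_gt0P; exists 0.
pose dual (xi : 'rV[K]_2) := - (C * xi 0 0 ^+ 2 - B * xi 0 0 * xi 0 1 + A * xi 0 1 ^+ 2) / (4 * A * C - B ^+ 2).
have E xi : q%:R * ft Z xi = (if xi == 0 then (q ^ 2)%:R else 0)
    + e * \sum_(j | j != 0) psi (j * F0 + dual xi / j).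
  transitivity (\sum_(v : 'rV[K]_2) (\sum_j psi (conic_poly A B C 0 0 F0 (v 0 0) (v 0 1) * j)) * psi (dot xi v)).
    rewrite /ft mulr_sumr big_mkcond /=; apply: eq_bigr => v _.
    by rewrite inE (sum_addchar_mul psiP); case: eqP => _; rewrite ?mul0r.
  under eq_bigr do rewrite mulr_suml.
  rewrite exchange_big /= (bigD1 0) //= -sum_dot; congr (_ + _).
    by apply: eq_bigr => v _; rewrite mulr0 psi0 mul1r dotC.
  rewrite mulr_sumr; apply: eq_bigr => j j0.
  rewrite psiD mulrCA -He // sum_rV2 mulr_sumr; apply: eq_bigr => x _.
  rewrite mulr_sumr; apply: eq_bigr => y _; rewrite -!psiD; congr psi.
  by rewrite /dot /conic_poly !rv0 !rv1; ring.
have nE xi : xi != 0 -> `|ft Z xi| = `|\sum_(j | j != 0) psi (j * F0 + dual xi / j)|.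
  move=> xi0; have /(congr1 Num.norm) := E xi; rewrite (negbTE xi0) add0r !normrM e1.
  by rewrite ger0_norm ?(ltW q0) // => /(mulfI (lt0r_neq0 q0)).
split=> [xi xi0||]; first by rewrite nE ?sum_kloosterman.
  all: have /eqP := E 0; rewrite eqxx addrC -subr_eq natrX expr2 -mulrBr => /eqP/(congr1 Num.norm).
  all: rewrite !normrM e1 (ger0_norm (ltW q0)) => /(mulfI (lt0r_neq0 q0)).
  all: rewrite (_ : ft Z 0 = #|Z|%:R); last first.
  1,3: rewrite /ft (eq_bigr (fun=> 1)) ?sumr_const // => v _; rewrite -psi0; congr psi; rewrite /dot !mxE; ring.
  all: rewrite (_ : \sum_(j | _) _ = - 1); last first.
  1,3: rewrite (eq_bigr (fun j => psi (F0 * j))) => [|j _]; last by congr psi; rewrite /dual !mxE; ring.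
  1,2: have := sum_addchar_mul psiP F0; rewrite (negbTE F00) (bigD1 0) //= mulr0 psi0.
  1,2: by move/eqP; rewrite addrC addr_eq0 => /eqP.
  all: rewrite normrN1 => H; have : `|#|Z|%:R - q%:R| <= 1 :> algC by rewrite H.
  all: rewrite real_ler_norml ?rpredB ?realn // => /andP[].
- by rewrite lerBrDr addrC lerBlDr natr1 ler_nat.
- by move=> _; rewrite lerBlDr nat1r ler_nat.
Qed.

(** The coefficient at [xi] is a Gauss sum with quadratic coefficient [al] and linear coefficient
    [be]. The determinant hypothesis prevents both from vanishing, so [al = 0] gives the value 0. *)
Lemma param_spectral (a0 a1 a2 b0 b1 b2 : K) : a0 * b1 - a1 * b0 != 0 ->
  spectral [set rv (a0 * s ^+ 2 + a1 * s + a2) (b0 * s ^+ 2 + b1 * s + b2) | s : K].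
Proof.
move=> d0; set p := fun s => rv _ _.
have inj : injective p.
  move=> s t E; have := congr1 (fun v : 'rV_2 => v 0 0) E.
  have := congr1 (fun v : 'rV_2 => v 0 1) E; rewrite !rv0 !rv1 => E1 E0.
  apply/eqP; rewrite -subr_eq0 -(mulrI_eq0 _ (lregP d0)); apply/eqP.
  have -> : (a0 * b1 - a1 * b0) * (s - t) =
     a0 * ((b0 * s ^+ 2 + b1 * s + b2) - (b0 * t ^+ 2 + b1 * t + b2))
     - b0 * ((a0 * s ^+ 2 + a1 * s + a2) - (a0 * t ^+ 2 + a1 * t + a2)) by ring.
  by rewrite E0 E1 !subrr !mulr0 subrr.
have cS : #|[set p s | s : K]| = q by rewrite card_imset //; apply: eq_card.
split; rewrite ?cS // => xi xi0.
rewrite /ft big_imset /=; last by move=> s t _ _; apply: inj.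
pose al := xi 0 0 * a0 + xi 0 1 * b0; pose be := xi 0 0 * a1 + xi 0 1 * b1.
rewrite (eq_bigr (fun s => psi (xi 0 0 * a2 + xi 0 1 * b2) * psi (al * s ^+ 2 + be * s))); last first.
  by move=> s _; rewrite -psiD /dot rv0 rv1; congr psi; rewrite /al /be; ring.
rewrite (eq_bigl xpredT) // -mulr_sumr normrM (addchar_norm psiP) mul1r.
have q1 : q%:R <= 4 * q%:R :> algC by rewrite -natrM ler_nat leq_pmull.
have [al0|al0] := eqVneq al 0; last first.
  by rewrite (gauss_linear psiP oK) // normrM (addchar_norm psiP) mulr1 (gauss_norm psiP oK).
have be0 : be != 0.
  apply: contraNneq xi0 => be0; apply/eqP; apply: rowP2; rewrite mxE;
  apply/eqP; rewrite -(mulrI_eq0 _ (lregP d0)); apply/eqP.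
    have -> : (a0 * b1 - a1 * b0) * xi 0 0 = al * b1 - be * b0 by rewrite /al /be; ring.
    by rewrite al0 be0 !mul0r subrr.
  have -> : (a0 * b1 - a1 * b0) * xi 0 1 = be * a0 - al * a1 by rewrite /al /be; ring.
  by rewrite al0 be0 !mul0r subrr.
rewrite (eq_bigr (fun s => psi (be * s))) => [|s _]; last by rewrite al0 mul0r add0r.
by rewrite (sum_addchar_mul psiP) (negbTE be0) normr0 expr0n mulr_ge0.
Qed.

End Spectral.

(** * Mixing and shattering *)

Section Mixing.
Variables (K : finFieldType) (psi : K -> algC).
Hypothesis psiP : addchar psi.
Local Notation q := #|K|.
Local Notation V := 'rV[K]_2.
Implicit Types (S P Q : {set V}) (s : V).

Let psi0 : psi 0 = 1. Proof. by case: psiP. Qed.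
Let psiD x y : psi (x + y) = psi x * psi y. Proof. by case: psiP. Qed.

Definition shift_cap P Q s : {set V} := [set y in Q | y + s \in P].

(** The number of pairs in [P] times [Q] with difference in [S], grouped by the difference;
    [edges_left] and [edges_right] group them by an endpoint. *)
Definition edges S P Q : nat := \sum_(s in S) #|shift_cap P Q s|.

Lemma ft_corr P Q s :
  \sum_xi psi (dot xi s) * ft psi Q xi * (ft psi P xi)^* = (q ^ 2 * #|shift_cap P Q s|)%:R.
Proof.
transitivity (\sum_xi \sum_(y in Q) \sum_(x in P) psi (dot xi (y + s - x))).
  apply: eq_bigr => xi _; rewrite /ft rmorph_sum -mulrA big_distrlr mulr_sumr.
  apply: eq_bigr => y _; rewrite mulr_sumr; apply: eq_bigr => x _ /=.
  by rewrite -(addcharN psiP) -!psiD !dotDr dotNr; congr psi; ring.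
rewrite exchange_big /=.
transitivity (\sum_(y in Q) (if y + s \in P then (q ^ 2)%:R else 0 : algC)).
  apply: eq_bigr => y _; rewrite exchange_big /=.
  under eq_bigr do rewrite (sum_dot psiP) subr_eq0 eq_sym.
  case: ifP => ys; last by apply: big1 => x xP; case: eqP => // E; rewrite -E xP in ys.
  rewrite (bigD1 (y + s)) //= eqxx big1 ?addr0 // => x /andP[_ /negbTE ->] //.
rewrite -big_mkcondr /= sumr_const -mulrnA; congr (_ *+ _); congr (_ * _)%N.
by apply: eq_card => y; rewrite !inE.
Qed.

Lemma parseval P : \sum_xi `|ft psi P xi| ^+ 2 = (q ^ 2 * #|P|)%:R.
Proof.
have := ft_corr P P 0.
rewrite (_ : shift_cap P P 0 = P) => [<-|]; last by apply/setP => y; rewrite inE addr0 andbb.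
apply: eq_bigr => xi _; rewrite normCK (_ : dot xi 0 = 0) ?psi0 ?mul1r //.
by rewrite /dot !mxE; ring.
Qed.

Lemma ft0 P : ft psi P 0 = #|P|%:R.
Proof.
rewrite /ft (eq_bigr (fun=> 1)) ?sumr_const // => v _; rewrite -psi0; congr psi.
by rewrite /dot !mxE; ring.
Qed.

(** The edges are a sum over frequencies whose term at 0 is the main term. The rest is bounded by
    [2 * m] times the products of coefficients of [P] and [Q], hence by Parseval after the
    inequality of arithmetic and geometric means, which keeps the statement in integers. *)
Lemma mixing S P Q m : spectral psi S -> (q <= m ^ 2)%N ->
  (#|S| * #|P| * #|Q| <= q ^ 2 * (edges S P Q + m * (#|P| + #|Q|)))%N.
Proof.
move=> [HS _ _] qm.
pose G xi := ft psi S xi * ft psi Q xi * (ft psi P xi)^*.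
have E : \sum_xi G xi = (q ^ 2 * edges S P Q)%:R.
  rewrite /edges big_distrr /= natr_sum; under [RHS]eq_bigr do rewrite -ft_corr.
  rewrite exchange_big /=; apply: eq_bigr => xi _.
  by rewrite /G {1}/ft !mulr_suml.
have E0 : G 0 = (#|S| * #|P| * #|Q|)%:R.
  by rewrite /G !ft0 conjC_nat -!natrM mulnAC.
rewrite (bigD1 0) //= E0 in E.
have bnd : `|\sum_(xi | xi != 0) G xi| <= (m * (q ^ 2 * (#|P| + #|Q|)))%:R.
  apply: le_trans (ler_norm_sum _ _ _) _.
  apply: (@le_trans _ _ (\sum_xi m%:R * (`|ft psi P xi| ^+ 2 + `|ft psi Q xi| ^+ 2))).
    rewrite [X in _ <= X](bigD1 0) //= -[X in X <= _]add0r; apply: lerD.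
      by rewrite mulr_ge0 // addr_ge0 // exprn_ge0.
    apply: ler_sum => xi xi0; rewrite /G !normrM norm_conjC.
    have leS : `|ft psi S xi| <= 2 * m%:R.
      rewrite -(@ler_pXn2r _ 2) ?nnegrE ?mulr_ge0 //.
      apply: le_trans (HS xi xi0) _; rewrite exprMn -!natrX -!natrM ler_nat.
      by rewrite leq_mul2l qm orbT.
    rewrite -mulrA; apply: (@le_trans _ _ (2 * m%:R * (`|ft psi Q xi| * `|ft psi P xi|))).
      by rewrite ler_wpM2r // mulr_ge0.
    rewrite [2 * _]mulrC -mulrA ler_wpM2l //.
    rewrite -subr_ge0 (_ : _ - _ = (`|ft psi P xi| - `|ft psi Q xi|) ^+ 2); last by ring.
    by rewrite real_exprn_even_ge0 // rpredB // normr_real.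
  by rewrite -mulr_sumr big_split /= !parseval -natrD -natrM -mulnDr lexx.
have := bnd; rewrite (_ : \sum_(xi | _) _ = (q ^ 2 * edges S P Q)%:R - (#|S| * #|P| * #|Q|)%:R).
  rewrite real_ler_norml ?rpredB ?realn // => /andP[+ _].
  rewrite lerBrDr addrC lerBlDr -natrD ler_nat; lia.
by rewrite -E [X in _ = X - _]addrC addrK.
Qed.

End Mixing.

Section VCGeneral.
Variables (K : finFieldType).
Local Notation V := 'rV[K]_2.
Implicit Types (S E : {set V}).

Lemma VCdim_ge S E n (x : 'I_n -> V) :
  injective x -> (forall i, x i \in E) ->
  (forall b : 'I_n -> bool, exists2 y, y \in E & forall i, (x i - y \in S) = b i) ->
  (n <= VCdim (hclass S E))%N.
Proof.
move=> xinj xE H; pose X i : {x : V | x \in E} := exist _ (x i) (xE i).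
have Xinj : injective X by move=> i j /(congr1 val) /xinj.
pose C := [set X i | i : 'I_n].
have XC i : X i \in C by apply: imset_f.
have <- : #|C| = n by rewrite card_imset // -[RHS]card_ord; apply: eq_card.
apply: (@leq_bigmax_cond _ (shatters (hclass S E)) (fun C => #|C|) C).
apply/forallP => g; pose b i := g (exist _ (X i) (XC i)).
have [y yE Hy] := H b.
apply/existsP; exists [ffun z : {x : V | x \in E} => val z - y \in S].
apply/andP; split; first by apply/imsetP; exists y.
apply/forallP => -[z zC]; rewrite ffunE /=; have /imsetP[i _ Ez] := zC.
have -> : exist _ z zC = exist _ (X i) (XC i) :> {z | z \in C} by apply: val_inj.
by rewrite Ez /= Hy.
Qed.

Definition self_cap S (v : V) : {set V} := [set u in S | u - v \in S].

(** If more than [k.+1] points were shattered, one translate would contain them all and another all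
    but [x0]; the distinct translates would share more than [k] points. *)
Lemma VCdim_le S E k :
  (forall v : V, v != 0 -> (#|self_cap S v| <= k)%N) ->
  (VCdim (hclass S E) <= k.+1)%N.
Proof.
move=> cap; apply/bigmax_leqP => C /forallP sh; rewrite leqNgt; apply/negP => kC.
have /card_gt0P[x0 x0C] : (0 < #|C|)%N by apply: leq_trans kC.
have [h1 /andP[/imsetP[y1 y1E ->]] /forallP H1] := existsP (sh [ffun=> true]).
have [h2 /andP[/imsetP[y2 y2E ->]] /forallP H2] := existsP (sh [ffun z => val z != x0]).
have {}H1 x : x \in C -> val x - y1 \in S.
  by move=> xC; have := H1 (exist _ x xC); rewrite !ffunE /= => /eqP ->.
have {}H2 x : x \in C -> (val x - y2 \in S) = (x != x0).
  by move=> xC; have := H2 (exist _ x xC); rewrite !ffunE /= => /eqP ->.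
have y12 : y2 - y1 != 0.
  rewrite subr_eq0; apply/negP => /eqP E12; have := H2 x0 x0C.
  by rewrite E12 H1 // eqxx.
have := cap _ y12; rewrite leqNgt => /negP; apply.
pose f (x : {x : V | x \in E}) := val x - y1.
have finj : injective f by move=> u v /addIr /val_inj.
apply: (@leq_trans #|f @: (C :\ x0)|).
  by rewrite card_imset //; move: kC; rewrite (cardsD1 x0) x0C add1n ltnS.
apply/subset_leq_card/subsetP => _ /imsetP[x /setD1P[xx0 xC] ->].
rewrite inE /f H1 //= (_ : _ - _ - _ = val x - y2) ?H2 //.
by rewrite opprB addrA subrK.
Qed.

Lemma VCdim_ge2 S E (x1 x2 : V) :
  x1 != x2 -> x1 \in E -> x2 \in E ->
  (forall b1 b2, exists2 y, y \in E & (x1 - y \in S) = b1 /\ (x2 - y \in S) = b2) ->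
  (2 <= VCdim (hclass S E))%N.
Proof.
move=> n12 x1E x2E H; pose x (i : 'I_2) := if i == 0 then x1 else x2.
have I2 (i : 'I_2) : {i = 0} + {i = 1}.
  by case: i => [[|[|i]] //] Hi; [left|right]; apply: val_inj.
apply: (@VCdim_ge S E 2 x) => [i j|i|b].
- case: (I2 i) => ->; case: (I2 j) => -> //; rewrite /x /= => E12; move: n12;
  by rewrite E12 eqxx.
- by rewrite /x; case: ifP.
have [y yE [H1 H2]] := H (b 0) (b 1); exists y => // i.
by case: (I2 i) => ->.
Qed.

Lemma VCdim_ge3 S E (x1 x2 x3 : V) :
  x1 != x2 -> x1 != x3 -> x2 != x3 -> x1 \in E -> x2 \in E -> x3 \in E ->
  (forall b1 b2 b3, exists2 y, y \in E &
     [/\ (x1 - y \in S) = b1, (x2 - y \in S) = b2 & (x3 - y \in S) = b3]) ->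
  (3 <= VCdim (hclass S E))%N.
Proof.
move=> n12 n13 n23 x1E x2E x3E H.
pose x (i : 'I_3) := if i == 0 then x1 else if i == 1 then x2 else x3.
have I3 (i : 'I_3) : [\/ i = 0, i = 1 | i = 2%:R].
  by case: i => [[|[|[|i]]] //] Hi; [apply: Or31|apply: Or32|apply: Or33]; apply: val_inj.
apply: (@VCdim_ge S E 3 x) => [i j|i|b].
- case: (I3 i) => ->; case: (I3 j) => -> //; rewrite /x /= => E12;
  by move: n12 n13 n23; rewrite E12 eqxx.
- by rewrite /x; case: ifP => _ //; case: ifP.
have [y yE [H1 H2 H3]] := H (b 0) (b 1) (b 2%:R); exists y => // i.
by case: (I3 i) => ->.
Qed.

(** At most [k] of the translates through [x1] also contain [x2], and at most [k] contain [x3]. *)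
Lemma private_neighbour (E T : {set V}) k (x1 x2 x3 : V) :
  (forall v, v != 0 -> (#|self_cap T v| <= k)%N) -> x1 != x2 -> x1 != x3 ->
  (2 * k < #|[set y in E | (x1 - y)%R \in T]|)%N ->
  exists2 y, y \in E & [/\ x1 - y \in T, x2 - y \notin T & x3 - y \notin T].
Proof.
move=> cap n12 n13 big; pose bad x := [set y | (x1 - y \in T) && (x - y \in T)].
have cbad x : x1 != x -> (#|bad x| <= k)%N.
  move=> nx; apply: leq_trans (cap (x1 - x) _); last by rewrite subr_eq0.
  have inj : injective (fun y => x1 - y) by move=> y z /addrI /oppr_inj.
  rewrite -(card_imset _ inj); apply/subset_leq_card/subsetP => _ /imsetP[y + ->].
  rewrite !inE => /andP[-> H] /=.
  by rewrite (_ : x1 - y - (x1 - x) = x - y) //; rewrite opprB addrC addrA subrK.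
have /subsetPn[y] : ~~ ([set y in E | x1 - y \in T] \subset bad x2 :|: bad x3).
  apply/negP => /subset_leq_card; rewrite leqNgt => /negP; apply.
  apply: leq_ltn_trans big; apply: leq_trans (leq_card_setU _ _) _.
  by rewrite mul2n -addnn leq_add // cbad.
rewrite !inE => /andP[yE y1]; rewrite y1 /= negb_or => /andP[y2 y3].
by exists y.
Qed.

Lemma no_neighbour (E T : {set V}) (x1 x2 x3 : V) : (3 * #|T| < #|E|)%N ->
  exists2 y, y \in E & [/\ x1 - y \notin T, x2 - y \notin T & x3 - y \notin T].
Proof.
move=> big; pose N x := [set x - t | t in T].
have cN x : (#|N x| <= #|T|)%N by apply: leq_imset_card.
have /subsetPn[y yE] : ~~ (E \subset N x1 :|: N x2 :|: N x3).
  apply/negP => /subset_leq_card; rewrite leqNgt => /negP; apply.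
  apply: leq_ltn_trans big; apply: leq_trans (leq_card_setU _ _) _.
  rewrite mulSn addnC leq_add //; apply: leq_trans (leq_card_setU _ _) _.
  by rewrite mul2n -addnn leq_add.
rewrite !inE !negb_or => /andP[/andP[y1 y2] y3]; exists y => //.
have H x : y \notin N x -> x - y \notin T.
  by apply: contra => xy; apply/imsetP; exists (x - y); rewrite ?subKr.
by split; apply: H.
Qed.

End VCGeneral.

Lemma edges_left (K : finFieldType) (S P Q : {set 'rV[K]_2}) :
  edges S P Q = (\sum_(x in P) #|[set y in Q | (x - y)%R \in S]|)%N.
Proof.
rewrite /edges; under eq_bigr do rewrite -sum1_card.
under [RHS]eq_bigr do rewrite -sum1_card.
rewrite !pair_big_dep /= (reindex (fun p : 'rV[K]_2 * 'rV[K]_2 => (p.1 - p.2, p.2))) /=.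
  by apply: eq_bigl => -[x y] /=; rewrite !inE [y + _]addrC subrK; case: (x \in P); rewrite ?andbF // andbT andbC.
by exists (fun p => (p.1 + p.2, p.2)) => -[x y] _ /=; rewrite ?subrK ?addrK.
Qed.

Lemma edges_right (K : finFieldType) (S P Q : {set 'rV[K]_2}) :
  edges S P Q = (\sum_(y in Q) #|[set x in P | (x - y)%R \in S]|)%N.
Proof.
rewrite edges_left; under eq_bigr do rewrite -sum1_card.
under [RHS]eq_bigr do rewrite -sum1_card.
rewrite (exchange_big_dep (mem Q)) /=; last by move=> x y _; rewrite inE => /andP[].
apply: eq_bigr => y yQ; apply: eq_bigl => x; rewrite !inE yQ andbC.
by case: (x \in P); rewrite ?andbT ?andbF.
Qed.

(** * Shattered pairs and triples in a large set *)

Section Large.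
Variables (K : finFieldType) (S E : {set 'rV[K]_2}) (m : nat).
Local Notation q := #|K|.
Local Notation V := 'rV[K]_2.
Hypothesis mix : forall P Q : {set V},
  (#|S| * #|P| * #|Q| <= q ^ 2 * (edges S P Q + m * (#|P| + #|Q|)))%N.
Hypotheses (Sge : (q <= #|S|.+1)%N) (Sle : (#|S| <= q.+1)%N) (m0 : (0 < m)%N).
(** The three conditions say that [core] and the sets reached after one and two popular directions
    stay above [128 * q * m]. The constants accumulate the loss of 2 from [card_core] and of
    [4 * q ^ 2] from each squaring of the density. *)
Hypothesis large1 : (256 * q * m < #|E|)%N.
Hypothesis large2 : forall n, (#|E| ^ 2 <= 16 * q ^ 2 * n -> 128 * q * m < n)%N.
Hypothesis large4 : forall n, (#|E| ^ 4 <= 1024 * q ^ 6 * n -> 128 * q * m < n)%N.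

Let q1 : (1 < q)%N. Proof. exact: finNzRing_gt1. Qed.
Let Sq : (q <= 2 * #|S|)%N. Proof. by move: Sge q1; lia. Qed.

Definition degree x := #|[set y in E | x - y \in S]|.
(** 17 is [2 * 8 + 1]: enough for [private_neighbour] when translates meet in at most 8 points. *)
Definition core := [set x in E | (17 <= degree x)%N].

(** Points outside [core] have at most 16 edges to [E] each; [mixing] forbids this for half of
    [E]. *)
Lemma card_core : (#|E| <= 2 * #|core|)%N.
Proof.
rewrite leqNgt; apply/negP => small.
pose B := E :\: core.
have cB : (#|B| + #|core| = #|E|)%N.
  rewrite -(cardsID core E) addnC; congr (_ + _)%N.
  by apply: eq_card => x; rewrite !inE; case: (x \in E).
have eB : (edges S B E <= 16 * #|B|)%N.
  rewrite edges_left -sum1_card big_distrr /=; apply: leq_sum => x.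
  rewrite !inE => /andP[+ xE]; rewrite xE /= -ltnNge ltnS muln1; apply.
have := mix B E; move: eB cB small large1 Sq m0 q1.
move: (edges S B E) (#|B|) (#|core|) (#|E|) (#|S|) => e b c n s eB cB small l1 sq m0' q1' H.
have {}H : (s * b * n <= q ^ 2 * (18 * m * n))%N.
  apply: leq_trans H _; rewrite leq_mul2l; apply/orP; right.
  apply: (@leq_trans (16 * n + m * (n + n))%N); last by nia.
  by apply: leq_add; [lia|rewrite leq_mul2l; lia].
have {}H : (s * b <= q ^ 2 * (18 * m))%N.
  by move: H; rewrite mulnA [(q ^ 2 * _)%N]mulnA leq_pmul2r //; lia.
have H2 : (q * n <= q * (q * (72 * m)))%N.
  apply: (@leq_trans (4 * (s * b))%N); last by move: H; rewrite -mulnn; lia.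
  apply: (@leq_trans (2 * s * (2 * b))%N); last by lia.
  by apply: leq_mul => //; lia.
by move: H2; rewrite leq_pmul2l ?(ltnW q1') //; lia.
Qed.

(** Averaging: were every allowed overlap below a quarter of the expected [#|P| ^ 2 / q ^ 2], the
    edges would be too few for [mixing], even with [#|P|] edges granted to each bad direction. *)
Lemma popular_direction (P bad : {set V}) :
  (128 * q * m < #|P|)%N -> (#|bad| <= 26)%N ->
  exists2 s, s \in S :\: bad & (#|P| ^ 2 <= 4 * q ^ 2 * #|shift_cap P P s|)%N.
Proof.
move=> bigP sbad.
have [/existsP[s /andP[sS H]]|/existsPn no] := boolP [exists s,
   (s \in S :\: bad) && (#|P| ^ 2 <= 4 * q ^ 2 * #|shift_cap P P s|)%N]; first by exists s.
exfalso; have e1 : (4 * q ^ 2 * edges S P P <= #|S| * #|P| ^ 2 + 4 * q ^ 2 * (26 * #|P|))%N.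
  rewrite /edges (bigID (mem bad)) /= mulnDr addnC; apply: leq_add.
    rewrite big_distrr /=; apply: (@leq_trans (\sum_(i in S) #|P| ^ 2)%N).
      rewrite big_mkcondr /=; apply: leq_sum => s sS; case: ifP => // sb.
      by have := no s; rewrite !inE sb sS /= -ltnNge; apply: ltnW.
    by rewrite sum_nat_const.
  rewrite leq_mul2l; apply/orP; right; apply: (@leq_trans (\sum_(i in bad) #|P|)%N).
    rewrite big_mkcondl /=; apply: leq_sum => s _; case: ifP => // _.
    by apply/subset_leq_card/subsetP => y; rewrite inE => /andP[].
  by rewrite sum_nat_const leq_mul2r sbad orbT.
have := mix P P; move: e1 bigP Sq m0 q1.
move: (edges S P P) (#|P|) (#|S|) => e n s e1 bigP sq m0' q1' H.
have H2 : (3 * s * n * n <= q ^ 2 * (112 * m) * n)%N.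
  rewrite -mulnn in e1.
  have : (4 * (s * n * n) <= 4 * q ^ 2 * e + 4 * q ^ 2 * (m * (n + n)))%N.
    by move: (q ^ 2)%N H => x; nia.
  have : (4 * q ^ 2 * (26 * n) <= q ^ 2 * (104 * m) * n)%N.
    by rewrite [(4 * _)%N]mulnC -!mulnA leq_mul2l; apply/orP; right; nia.
  by move: (q ^ 2)%N e1 => x; nia.
have {}H2 : (3 * s * n <= q ^ 2 * (112 * m))%N.
  by move: H2; rewrite leq_pmul2r //; lia.
have H3 : (q * n <= q * (q * (75 * m)))%N.
  by rewrite -mulnn in H2; nia.
by move: H3; rewrite leq_pmul2l ?(ltnW q1') //; lia.
Qed.
Lemma card_S_small : (3 * (2 * #|S|) < #|E|)%N.
Proof.
have qm : (q <= q * m)%N by rewrite leq_pmulr.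
move: large1 Sle q1 qm; rewrite -mulnA.
by move: (q * m)%N (#|S|) (#|E|) (#|K|) => a b c d; clear; lia.
Qed.

(** Some [y] sees two core points, since otherwise there would be at most [#|E|] edges from [core]
    to [E]. Their degrees then provide the patterns with a single point. *)
Lemma VCdim_ge2_large :
  (forall v, v != 0 -> (#|self_cap S v| <= 8)%N) -> (2 <= VCdim (hclass S E))%N.
Proof.
move=> cap.
have [/existsP[y /andP[yE /card_gt1P[x1 [x2 [+ + n12]]]]]|/existsPn no] := boolP
    [exists y, (y \in E) && (1 < #|[set x in core | (x - y)%R \in S]|)%N].
  rewrite !inE => /andP[/andP[x1E d1] s1] /andP[/andP[x2E d2] s2].
  apply: (VCdim_ge2 n12 x1E x2E) => -[] [].
  - by exists y.
  - by have [z zE [H1 /negbTE H2 _]] := private_neighbour cap n12 n12 d1; exists z.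
  - move: n12; rewrite eq_sym => n21.
    by have [z zE [H1 /negbTE H2 _]] := private_neighbour cap n21 n21 d2; exists z.
  have [|z zE [/negbTE H1 /negbTE H2 _]] := @no_neighbour _ E S x1 x2 x2.
    by apply: leq_ltn_trans card_S_small; rewrite leq_mul2l leq_pmull ?orbT.
  by exists z.
exfalso; have e1 : (edges S core E <= #|E|)%N.
  rewrite edges_right -sum1_card; apply: leq_sum => y yE.
  by have := no y; rewrite yE /= -leqNgt.
have cE : (#|core| <= #|E|)%N.
  by apply/subset_leq_card/subsetP => x; rewrite inE => /andP[].
have := mix core E; move: e1 cE card_core large1 Sq m0 q1.
move: (edges S core E) (#|core|) (#|E|) (#|S|) => e c n s e1 cE cc l1 sq m0' q1' H.
have {}H : (s * c * n <= q ^ 2 * (3 * m) * n)%N.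
  apply: leq_trans H _; rewrite -mulnA leq_mul2l; apply/orP; right; nia.
have {}H : (s * c <= q ^ 2 * (3 * m))%N.
  by move: H; rewrite leq_pmul2r //; lia.
have H2 : (q * n <= q * (q * (12 * m)))%N.
  rewrite -mulnn in H; nia.
by move: H2; rewrite leq_pmul2l ?(ltnW q1') //; lia.
Qed.

(** Symmetry of [T] matters because [y + si + sj] sees [y + si] through the difference [- sj]. The
    directions themselves are taken in [S], to which [mixing] applies. *)
Lemma VCdim_ge3_large (T := S :|: opp_set S) :
  (forall v, v != 0 -> (#|self_cap T v| <= 8)%N) -> (3 <= VCdim (hclass T E))%N.
Proof.
move=> cap.
have TN v : (- v \in T) = (v \in T).
  have H w : w \in T -> - w \in T.
    rewrite !inE => /orP[wS|/imsetP[s sS ->]]; apply/orP; last by left; rewrite opprK.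
    by right; apply/imsetP; exists w.
  by apply/idP/idP => /H; rewrite ?opprK.
have ST v : v \in S -> v \in T by rewrite inE => ->.
have capS v : v != 0 -> (#|[set s in S | (s - v)%R \in T]| <= 8)%N.
  move=> v0; apply: leq_trans (cap v v0); apply/subset_leq_card/subsetP => s.
  by rewrite !inE => /andP[-> ->].
have cE := card_core.
pose E1 s := shift_cap core core s.
have b0 : (128 * q * m < #|core|)%N by move: cE large1; lia.
have [|s1 /setDP[s1S _] H1] := popular_direction (bad := set0) b0; first by rewrite cards0.
have b1 : (128 * q * m < #|E1 s1|)%N.
  apply: large2; apply: (@leq_trans ((2 * #|core|) ^ 2)%N); first by rewrite leq_exp2r.
  rewrite expnMn; move: H1; rewrite -/(E1 s1).
  by move: (q ^ 2)%N (#|E1 s1|) (#|core| ^ 2)%N => a b c; nia.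
(* Excluding [s1] and [- s1] makes [s1 - s2] and [s1 + s2] nonzero, so that [capS] applies to these
   shifts below. *)
have [|s2 /setDP[s2S s2b] H2] := popular_direction (bad := [set s1; - s1]) b1.
  by rewrite cards2; case: (_ == _).
pose E2 := shift_cap (E1 s1) (E1 s1) s2.
have b2 : (128 * q * m < #|E2|)%N.
  apply: large4; apply: (@leq_trans ((2 * #|core|) ^ 4)%N); first by rewrite leq_exp2r.
  move: H1 H2; rewrite -/(E1 s1) -/E2 expnMn (expnM #|core| 2 2) (expnM q 2 3).
  move: (#|core| ^ 2)%N (q ^ 2)%N (#|E1 s1|) (#|E2|) => c a n1 n2 H1 H2.
  have : (c ^ 2 <= (4 * a * n1) ^ 2)%N by rewrite leq_exp2r.
  have : (a ^ 2 * n1 ^ 2 <= a ^ 2 * (4 * a * n2))%N by rewrite leq_mul2l H2 orbT.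
  by rewrite !expnMn (expnS a 2); move: (c ^ 2)%N (a ^ 2)%N (n1 ^ 2)%N => x y z; nia.
have n12 : s1 != s2 by move: s2b; rewrite !inE negb_or eq_sym => /andP[].
have n12' : s1 + s2 != 0.
  by move: s2b; rewrite !inE negb_or addrC addr_eq0 => /andP[].
(* Avoiding [C (s1 + s2)] keeps [y + s1 + s2] from seeing [y + s3]; the other two sets serve the
   other pairs. In all at most 2 + 3 * 8 = 26 directions are excluded. *)
pose C v := [set s in S | s - v \in T].
pose bad := [set s1; s2] :|: (C (s1 + s2) :|: (C (s2 - s1) :|: C (s1 - s2))).
have [|s3 /setDP[s3S s3b] H3] := popular_direction (bad := bad) b2.
  apply: leq_trans (leq_card_setU _ _) _; apply: (@leq_trans (2 + (8 + (8 + 8)))) => //.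
  apply: leq_add; first by rewrite cards2; case: (_ == _).
  apply: leq_trans (leq_card_setU _ _) _; apply: leq_add; first exact: capS.
  apply: leq_trans (leq_card_setU _ _) _.
  by apply: leq_add; apply: capS; rewrite subr_eq0 // eq_sym.
have inC v : s3 \notin C v -> s3 - v \notin T.
  by apply: contra => h; rewrite in_set s3S h.
move: s3b; rewrite !in_setU !in_set1 !negb_or.
case/andP => /andP[n31 n32] /and3P[/inC t1 /inC t2 /inC t3].
have [y] : exists y, y \in shift_cap E2 E2 s3.
  apply/card_gt0P; rewrite lt0n; apply: contraTneq H3 => ->.
  by rewrite muln0 -ltnNge expn_gt0 (leq_ltn_trans _ b2).
have capP (P : {set V}) z s : z \in shift_cap P P s -> z \in P /\ z + s \in P.
  by rewrite inE => /andP[].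
case/capP => /capP[/capP[y0 y1] /capP[y2 y12]] /capP[/capP[y3 y13] /capP[y23 _]].
have coreE z : z \in core -> z \in E by rewrite inE => /andP[].
have deg z : z \in core -> (2 * 8 < #|[set w in E | (z - w)%R \in T]|)%N.
  rewrite inE => /andP[_ /leq_trans]; apply; apply/subset_leq_card/subsetP => w.
  by rewrite !inE => /andP[-> ->].
have yn (s t : V) : s != t -> y + s != y + t by rewrite (inj_eq (addrI y)).
have sub (s t : V) : y + s - (y + t) = s - t by rewrite opprD addrACA subrr add0r.
have n21 : s2 != s1 by rewrite eq_sym.
have [n13 n23] : s1 != s3 /\ s2 != s3 by rewrite ![_ == s3]eq_sym.
apply: (@VCdim_ge3 _ T E (y + s1) (y + s2) (y + s3)); rewrite ?yn ?coreE //.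
(* In order: all three points, the pairs 12 and 13, point 1 alone, the pair 23, points 2 and 3
   alone, none. *)
case=> [] [] [].
- by exists y; rewrite ?coreE // !(addrC y) !addrK !ST.
- exists (y + (s1 + s2)); first by rewrite addrA -(addrAC y s2 s1) coreE.
  rewrite !sub; split; last by apply/negbTE.
    by rewrite opprD addrA subrr add0r TN ST.
  by rewrite opprD addrCA subrr addr0 TN ST.
- exists (y + (s1 + s3)); first by rewrite addrA -(addrAC y s3 s1) coreE.
  rewrite !sub; split; last by rewrite opprD addrCA subrr addr0 TN ST.
    by rewrite opprD addrA subrr add0r TN ST.
  by rewrite -TN opprB; apply/negbTE; move: t2; rewrite opprB addrA [s3 + s1]addrC.
- by have [z zE [h1 /negbTE h2 /negbTE h3]] := private_neighbour cap (yn _ _ n12) (yn _ _ n13) (deg _ y1); exists z.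
- exists (y + (s2 + s3)); first by rewrite addrA -(addrAC y s3 s2) coreE.
  rewrite !sub; split; last by rewrite opprD addrCA subrr addr0 TN ST.
    by rewrite -TN opprB; apply/negbTE; move: t3; rewrite opprB addrA [s3 + s2]addrC.
  by rewrite opprD addrA subrr add0r TN ST.
- by have [z zE [h1 /negbTE h2 /negbTE h3]] := private_neighbour cap (yn _ _ n21) (yn _ _ n23) (deg _ y2); exists z.
- by have [z zE [h1 /negbTE h2 /negbTE h3]] := private_neighbour cap (yn _ _ n31) (yn _ _ n32) (deg _ y3); exists z.
have [|z zE [/negbTE h1 /negbTE h2 /negbTE h3]] := @no_neighbour _ E T (y + s1) (y + s2) (y + s3); last by exists z.
have cT : (#|T| <= 2 * #|S|)%N.
  by apply: leq_trans (leq_card_setU _ _) _; rewrite mul2n -addnn leq_add2l leq_imset_card.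
by apply: leq_ltn_trans card_S_small; rewrite leq_mul2l cT orbT.
Qed.

End Large.

(** * Intersections of translates of a conic *)

Lemma det_mx2 (R : comPzRingType) (M : 'M[R]_2) : \det M = M 0 0 * M 1 1 - M 0 1 * M 1 0.
Proof.
rewrite (expand_det_row _ 0) !big_ord_recl big_ord0 /cofactor !det_mx11 !mxE /=.
rewrite addr0 expr0 mul1r expr1 mulN1r mulrN; congr (_ * M _ _ - M _ _ * M _ _); exact: val_inj.
Qed.

Section ConicGeometry.
Variable K : finFieldType.
Hypothesis oK : odd #|K|.
Local Notation V := 'rV[K]_2.
Implicit Types (A B C D E F : K) (u v w p t : V).

Let n2 : 2%:R != 0 :> K. Proof. exact: odd_card_two_neq0. Qed.
Let n4 : 4%:R != 0 :> K. Proof. by rewrite (_ : 4%:R = 2%:R * 2%:R) ?mulf_neq0 // -natrM. Qed.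

Definition conic_disc A B C D E F : K :=
  4 * A * C * F + B * D * E - A * E ^+ 2 - C * D ^+ 2 - B ^+ 2 * F.

Definition quad_disc A B C : K := 4 * A * C - B ^+ 2.

Lemma det_conic_mx A B C D E F :
  4 * \det (conic_mx A B C D E F) = conic_disc A B C D E F.
Proof.
rewrite (expand_det_row _ 0) !big_ord_recl big_ord0 /cofactor !det_mx2 !mxE /=.
by rewrite /conic_disc; field; rewrite ?n2.
Qed.

Lemma det_conic_quad_mx A B C : 4 * \det (conic_quad_mx A B C) = quad_disc A B C.
Proof. by rewrite det_mx2 !mxE /= /quad_disc; field; rewrite ?n2. Qed.

Lemma mem_conic A B C D E F v :
  (v \in conic_zeros A B C D E F) = (conic_poly A B C D E F (v 0 0) (v 0 1) == 0).
Proof. by rewrite inE. Qed.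

Lemma conic_translate A B C D E F t :
  [set z + t | z in conic_zeros A B C D E F] =
  conic_zeros A B C (D - 2 * A * t 0 0 - B * t 0 1) (E - B * t 0 0 - 2 * C * t 0 1)
    (conic_poly A B C D E F (- t 0 0) (- t 0 1)).
Proof.
apply/setP => v; rewrite mem_conic; apply/imsetP/eqP => [[z]|H].
  rewrite mem_conic => /eqP zE ->; rewrite !mxE -[RHS]zE /conic_poly; ring.
exists (v - t); last by rewrite subrK.
by rewrite mem_conic !mxE -H /conic_poly; apply/eqP; ring.
Qed.

Lemma conic_disc_translate A B C D E F (x y : K) :
  conic_disc A B C (D - 2 * A * x - B * y) (E - B * x - 2 * C * y)
    (conic_poly A B C D E F (- x) (- y)) = conic_disc A B C D E F.
Proof. by rewrite /conic_disc /conic_poly; ring. Qed.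

(** On the line the equation is a quadratic polynomial in a parameter. Three roots make it vanish
    identically, and a conic containing a line is degenerate. *)
Lemma conic_line A B C D E F (al be ga : K) :
  conic_disc A B C D E F != 0 -> (al != 0) || (be != 0) ->
  (#|[set p in conic_zeros A B C D E F | (al * p 0 0 + be * p 0 1)%R == ga]| <= 2)%N.
Proof.
move=> disc0 ab0; rewrite leqNgt; apply/negP => /card_gt2P[u [v [w [[+ + +] [nuv nvw nwu]]]]].
rewrite !inE => /andP[/eqP fu /eqP lu] /andP[/eqP fv /eqP lv] /andP[/eqP fw /eqP lw].
have dir p : al * p 0 0 + be * p 0 1 = ga ->
    exists s, p 0 0 = u 0 0 - s * be /\ p 0 1 = u 0 1 + s * al.
  move=> lp; have E1 : al * (p 0 0 - u 0 0) + be * (p 0 1 - u 0 1) = 0.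
    transitivity ((al * p 0 0 + be * p 0 1) - (al * u 0 0 + be * u 0 1)); first by ring.
    by rewrite lp lu subrr.
  case: (eqVneq al 0) ab0 E1 => [->|al0] /= ab0 E1.
    exists (- (p 0 0 - u 0 0) / be); split; first by field.
    move/eqP: E1; rewrite mul0r add0r mulf_eq0 (negbTE ab0) subr_eq0 => /eqP ->; ring.
  exists ((p 0 1 - u 0 1) / al); split; last by field.
  apply: (mulfI al0); move/eqP: E1; rewrite addr_eq0 mulrBr subr_eq => /eqP ->.
  by field.
pose c2 := A * be ^+ 2 - B * be * al + C * al ^+ 2.
pose c1 := - (2 * A * u 0 0 + B * u 0 1 + D) * be + (B * u 0 0 + 2 * C * u 0 1 + E) * al.
have root p s : p != u -> p 0 0 = u 0 0 - s * be -> p 0 1 = u 0 1 + s * al ->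
    conic_poly A B C D E F (p 0 0) (p 0 1) = 0 -> s != 0 /\ c1 + s * c2 = 0.
  move=> pu p0 p1 fp; have s0 : s != 0.
    apply: contraNneq pu => s0; apply/eqP/rowP2; first by rewrite p0 s0; ring.
    by rewrite p1 s0; ring.
  split=> //; apply: (mulfI s0); rewrite mulr0 -[RHS]fp p0 p1.
  by rewrite -[LHS]addr0 -fu /conic_poly /c1 /c2; ring.
have [s [vs0 vs1]] := dir v lv; have [r [wr0 wr1]] := dir w lw.
have nvu : v != u by rewrite eq_sym.
have [s0 Es] := root v s nvu vs0 vs1 fv; have [r0 Er] := root w r nwu wr0 wr1 fw.
have c20 : c2 = 0.
  have sr : s - r != 0.
    rewrite subr_eq0; apply: contraNneq nvw => sr.
    by apply/eqP/rowP2; rewrite ?vs0 ?vs1 ?wr0 ?wr1 sr.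
  apply: (mulfI sr); rewrite mulr0 -[RHS](subrr 0) -{1}Es -Er; ring.
have c10 : c1 = 0 by move: Es; rewrite c20 mulr0 addr0.
(* [gen] expands a Gram determinant of the doubled conic matrix on the point [u], the direction of
   the line and a coordinate vector. It vanishes with [a], [c1] and [c2], while change of basis
   makes it the stated multiple of the discriminant. *)
have [g1 g2] : 2 * be ^+ 2 * conic_disc A B C D E F = 0 /\
               2 * al ^+ 2 * conic_disc A B C D E F = 0.
  pose a := 2 * conic_poly A B C D E F (u 0 0) (u 0 1).
  have gen x y z : a * (2 * c2 * z - y ^+ 2) - c1 * (c1 * z - x * y) + x * (c1 * y - 2 * c2 * x) = 0.
    by rewrite /a fu c20 c10; ring.
  split.
    rewrite -(gen (B * u 0 0 + 2 * C * u 0 1 + E) (- B * be + 2 * C * al) (2 * C)).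
    by rewrite /a /c1 /c2 /conic_poly /conic_disc; ring.
  rewrite -(gen (2 * A * u 0 0 + B * u 0 1 + D) (- 2 * A * be + B * al) (2 * A)).
  by rewrite /a /c1 /c2 /conic_poly /conic_disc; ring.
move: disc0; case/orP: ab0 => nz; [move: g2|move: g1] => /eqP;
  by rewrite !mulf_eq0 (negbTE n2) (negbTE nz) /= => ->.
Qed.

(** Subtracting the equations of the two translates cancels the quadratic part. What remains is a
    genuine line, since the quadratic form has no radical. *)
Lemma conic_self_cap A B C D E F v : conic_disc A B C D E F != 0 -> quad_disc A B C != 0 ->
  v != 0 -> (#|self_cap (conic_zeros A B C D E F) v| <= 2)%N.
Proof.
move=> disc0 qd v0.
pose al := 2 * A * v 0 0 + B * v 0 1; pose be := B * v 0 0 + 2 * C * v 0 1.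
pose ga := A * v 0 0 ^+ 2 + B * v 0 0 * v 0 1 + C * v 0 1 ^+ 2 - D * v 0 0 - E * v 0 1.
have ab : (al != 0) || (be != 0).
  apply: contraNT v0; rewrite negb_or !negbK => /andP[/eqP a0 /eqP b0].
  apply/eqP/rowP2; rewrite mxE; apply: (mulfI qd); rewrite mulr0.
    transitivity (2 * C * al - B * be); first by rewrite /al /be /quad_disc; ring.
    by rewrite a0 b0 !mulr0 subrr.
  transitivity (2 * A * be - B * al); first by rewrite /al /be /quad_disc; ring.
  by rewrite a0 b0 !mulr0 subrr.
apply: leq_trans (conic_line ga disc0 ab); apply/subset_leq_card/subsetP => p.
rewrite inE !mem_conic !mxE => /andP[/eqP f1 /eqP f2]; rewrite inE mem_conic f1 eqxx /=.
apply/eqP/subr0_eq; transitivity (conic_poly A B C D E F (p 0 0) (p 0 1)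
  - conic_poly A B C D E F (p 0 0 - v 0 0) (p 0 1 - v 0 1)); last by rewrite f1 f2 subrr.
by rewrite /conic_poly /al /be /ga; ring.
Qed.

(** The hypotheses say that the doubled conic matrix kills [(v, 0)]; the combinations used are rows
    of its adjugate. *)
Lemma conic_kernel A B C D E F v : conic_disc A B C D E F != 0 ->
  2 * A * v 0 0 + B * v 0 1 = 0 -> B * v 0 0 + 2 * C * v 0 1 = 0 ->
  D * v 0 0 + E * v 0 1 = 0 -> v = 0.
Proof.
set x := v 0 0; set y := v 0 1 => disc0 e1 e2 e3.
have d2 : 2 * conic_disc A B C D E F != 0 by rewrite mulf_neq0.
apply: rowP2; rewrite mxE -/x -/y; apply: (mulfI d2); rewrite mulr0.
  transitivity ((2 * A * x + B * y) * (4 * C * F - E ^+ 2) - (B * x + 2 * C * y) * (2 * B * F - D * E)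
      + (D * x + E * y) * (B * E - 2 * C * D)); first by rewrite /conic_disc; ring.
  by rewrite e1 e2 e3; ring.
transitivity (- (2 * A * x + B * y) * (2 * B * F - D * E) + (B * x + 2 * C * y) * (4 * A * F - D ^+ 2)
      - (D * x + E * y) * (2 * A * E - B * D)); first by rewrite /conic_disc; ring.
by rewrite e1 e2 e3; ring.
Qed.

(** Two common points with difference [d] would make [d] and [v] orthogonal for the polar form. As
    that form has rank at most one, [v] or [d] lies in its radical, and the equations of the conic
    then put it in the kernel of [conic_kernel]. *)
Lemma parabola_self_cap A B C D E F v : conic_disc A B C D E F != 0 -> quad_disc A B C = 0 ->
  v != 0 -> (#|self_cap (conic_zeros A B C D E F) v| <= 1)%N.
Proof.
move=> disc0 qd v0; rewrite leqNgt; apply/negP => /card_gt1P[p [p' [+ + npp]]].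
rewrite !inE !mxE => /andP[/eqP f1 /eqP f2] /andP[/eqP g1 /eqP g2].
pose al := 2 * A * v 0 0 + B * v 0 1; pose be := B * v 0 0 + 2 * C * v 0 1.
pose d := p' - p; pose a' := 2 * A * d 0 0 + B * d 0 1; pose b' := B * d 0 0 + 2 * C * d 0 1.
have eq0 (x : K) : 2 * x = 0 -> x = 0 by move/eqP; rewrite mulf_eq0 (negbTE n2) => /eqP.
have L : al * d 0 0 + be * d 0 1 = 0.
  transitivity ((conic_poly A B C D E F (p' 0 0) (p' 0 1)
      - conic_poly A B C D E F (p' 0 0 - v 0 0) (p' 0 1 - v 0 1))
    - (conic_poly A B C D E F (p 0 0) (p 0 1)
      - conic_poly A B C D E F (p 0 0 - v 0 0) (p 0 1 - v 0 1))).
    by rewrite /al /be /d !mxE /conic_poly; ring.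
  by rewrite f1 f2 g1 g2 !subrr.
have [/andP[/eqP a0 /eqP b0]|ab0] := boolP ((al == 0) && (be == 0)).
  move/negP: v0; apply; apply/eqP; apply: (conic_kernel disc0 a0 b0); apply: eq0.
  transitivity (2 * (conic_poly A B C D E F (p 0 0) (p 0 1)
      - conic_poly A B C D E F (p 0 0 - v 0 0) (p 0 1 - v 0 1))
      - 2 * (al * p 0 0 + be * p 0 1) + (al * v 0 0 + be * v 0 1)).
    by rewrite /al /be /conic_poly; ring.
  by rewrite f1 f2 a0 b0; ring.
have Ha : a' = 0.
  move: ab0; rewrite negb_and => /orP[] nz; apply: (mulfI nz); rewrite mulr0.
    transitivity (2 * A * (al * d 0 0 + be * d 0 1) - quad_disc A B C * v 0 1 * d 0 1);
      [by rewrite /al /be /a' /quad_disc; ring|by rewrite L qd; ring].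
  transitivity (B * (al * d 0 0 + be * d 0 1) + quad_disc A B C * v 0 1 * d 0 0);
    [by rewrite /al /be /a' /quad_disc; ring|by rewrite L qd; ring].
have Hb : b' = 0.
  move: ab0; rewrite negb_and => /orP[] nz; apply: (mulfI nz); rewrite mulr0.
    transitivity (B * (al * d 0 0 + be * d 0 1) + quad_disc A B C * v 0 0 * d 0 1);
      [by rewrite /al /be /b' /quad_disc; ring|by rewrite L qd; ring].
  transitivity (2 * C * (al * d 0 0 + be * d 0 1) - quad_disc A B C * v 0 0 * d 0 0);
    [by rewrite /al /be /b' /quad_disc; ring|by rewrite L qd; ring].
suff d0 : d = 0 by move/negP: npp; apply; rewrite eq_sym -subr_eq0 -/d d0.
apply: (conic_kernel disc0 Ha Hb); apply: eq0.
transitivity (2 * (conic_poly A B C D E F (p' 0 0) (p' 0 1) - conic_poly A B C D E F (p 0 0) (p 0 1))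
  - 2 * (a' * p 0 0 + b' * p 0 1) - (a' * d 0 0 + b' * d 0 1)).
  by rewrite /a' /b' /d !mxE /conic_poly; ring.
by rewrite f1 g1 Ha Hb; ring.
Qed.

Definition anti_cap (S : {set V}) v : {set V} := [set u in S | v - u \in S].

(** The difference of the two equations is again linear in [p]; its coefficients vanish together
    only if half of [v] is a centre, and a parabola has none. *)
Lemma parabola_anti_cap A B C D E F v : conic_disc A B C D E F != 0 -> quad_disc A B C = 0 ->
  (#|anti_cap (conic_zeros A B C D E F) v| <= 2)%N.
Proof.
move=> disc0 qd.
pose al := 2 * A * v 0 0 + B * v 0 1 + 2 * D; pose be := B * v 0 0 + 2 * C * v 0 1 + 2 * E.
pose ga := A * v 0 0 ^+ 2 + B * v 0 0 * v 0 1 + C * v 0 1 ^+ 2 + D * v 0 0 + E * v 0 1.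
have ab : (al != 0) || (be != 0).
  apply: contraNT disc0; rewrite negb_or !negbK => /andP[/eqP a0 /eqP b0].
  apply/eqP; apply: (mulfI n4); rewrite mulr0.
  pose X := 2 * A * v 0 0 + B * v 0 1; pose Y := B * v 0 0 + 2 * C * v 0 1.
  transitivity (4 * F * quad_disc A B C + B * (al - X) * (be - Y) - A * (be - Y) ^+ 2 - C * (al - X) ^+ 2).
    by rewrite /al /be /X /Y /conic_disc /quad_disc; ring.
  rewrite a0 b0; transitivity (quad_disc A B C * (4 * F - (A * v 0 0 ^+ 2 + B * v 0 0 * v 0 1 + C * v 0 1 ^+ 2))).
    by rewrite /X /Y /quad_disc; ring.
  by rewrite qd mul0r.
apply: leq_trans (conic_line ga disc0 ab); apply/subset_leq_card/subsetP => p.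
rewrite inE !mem_conic !mxE => /andP[/eqP f1 /eqP f2]; rewrite inE mem_conic f1 eqxx /=.
apply/eqP/subr0_eq; transitivity (conic_poly A B C D E F (p 0 0) (p 0 1)
  - conic_poly A B C D E F (v 0 0 - p 0 0) (v 0 1 - p 0 1)); last by rewrite f1 f2 subrr.
by rewrite /conic_poly /al /be /ga; ring.
Qed.

(** Equal signs for [u] and [u - v] give self-intersections, opposite signs give intersections with
    a reflection: 1 + 1 + 2 + 2 points, within the common bound 8. *)
Lemma parabola_sym_cap A B C D E F v : conic_disc A B C D E F != 0 -> quad_disc A B C = 0 ->
  v != 0 ->
  (#|self_cap (conic_zeros A B C D E F :|: opp_set (conic_zeros A B C D E F)) v| <= 8)%N.
Proof.
move=> disc0 qd v0; set S := conic_zeros _ _ _ _ _ _.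
have NS w : (w \in opp_set S) = (- w \in S).
  apply/imsetP/idP => [[s sS ->]|h]; first by rewrite opprK.
  by exists (- w) => //; rewrite opprK.
have vN0 : - v != 0 by rewrite oppr_eq0.
pose N (P : {set V}) := [set - u | u in P].
have cN P : (#|N P| <= #|P|)%N by apply: leq_imset_card.
apply: (@leq_trans #|(self_cap S v :|: N (self_cap S (- v))) :|: (anti_cap S v :|: N (anti_cap S (- v)))|).
  apply/subset_leq_card/subsetP => u.
  rewrite in_set !in_setU !NS opprB => /andP[/orP[h1|h1] /orP[h2|h2]].
  - by rewrite [u \in self_cap S v]in_set h1 h2.
  - by rewrite [u \in anti_cap S v]in_set h1 h2 !orbT.
  - apply/orP; right; apply/orP; right; apply/imsetP; exists (- u); last by rewrite opprK.
    by rewrite in_set h1 opprK addrC.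
  - apply/orP; left; apply/orP; right; apply/imsetP; exists (- u); last by rewrite opprK.
    by rewrite in_set h1 opprK addrC.
apply: leq_trans (leq_card_setU _ _) _; apply: (@leq_trans ((1 + 1) + (2 + 2))) => //.
apply: leq_add; apply: leq_trans (leq_card_setU _ _) _; apply: leq_add.
- exact: parabola_self_cap.
- by apply: leq_trans (cN _) _; apply: parabola_self_cap.
- exact: parabola_anti_cap.
- by apply: leq_trans (cN _) _; apply: parabola_anti_cap.
Qed.
End ConicGeometry.

(** * Fourier bounds for general conics by normal forms *)

Section ConicSpectral.
Variables (K : finFieldType) (psi : K -> algC).
Hypotheses (psiP : addchar psi) (oK : odd #|K|).
Variables A B C D E F : K.
Hypothesis disc0 : conic_disc A B C D E F != 0.
Local Notation Z := (conic_zeros A B C D E F).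

Let n2 : 2%:R != 0 :> K. Proof. exact: odd_card_two_neq0. Qed.
Let n4 : 4%:R != 0 :> K. Proof. by rewrite (_ : 4%:R = 2%:R * 2%:R) ?mulf_neq0 // -natrM. Qed.

(** The translation by Cramer's rule removes the linear terms; the remaining constant is nonzero
    because the discriminant is invariant. *)
Lemma conic_center : quad_disc A B C != 0 ->
  exists t F0, F0 != 0 /\ [set z + t | z in Z] = conic_zeros A B C 0 0 F0.
Proof.
move=> qd; pose x := (2 * C * D - B * E) / quad_disc A B C.
pose y := (2 * A * E - B * D) / quad_disc A B C.
exists (rv x y), (conic_poly A B C D E F (- x) (- y)).
have Dx : D - 2 * A * x - B * y = 0.
  by rewrite /x /y; move: qd; rewrite /quad_disc => qd; field.
have Ex : E - B * x - 2 * C * y = 0.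
  by rewrite /x /y; move: qd; rewrite /quad_disc => qd; field.
split; last by rewrite conic_translate rv0 rv1 Dx Ex.
apply: contraNneq disc0 => F0; rewrite -(conic_disc_translate A B C D E F x y) Dx Ex F0.
by apply/eqP; rewrite /conic_disc; ring.
Qed.

Lemma translate_back (t : 'rV[K]_2) (S : {set 'rV[K]_2}) :
  [set z + - t | z in [set z + t | z in S]] = S.
Proof.
rewrite -imset_comp (eq_imset _ (g := id)) ?imset_id // => z /=.
by rewrite addrK.
Qed.

Lemma nondegenerate_spectral : quad_disc A B C != 0 -> spectral psi Z.
Proof.
move=> qd; have [t [F0 [F00 E0]]] := conic_center qd.
rewrite -(translate_back t Z) E0; apply: spectral_translate => //.
exact: conic_spectral.
Qed.

(** The quadratic part is a multiple of the square of one linear form. That form serves as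
    parameter, and both coordinates are quadratic polynomials in it. *)
Lemma parabola_spectral : quad_disc A B C = 0 -> spectral psi Z.
Proof.
move=> qd; have [A0|A0] := eqVneq A 0.
  have B0 : B = 0.
    by move/eqP: qd; rewrite /quad_disc A0 mulr0 mul0r sub0r oppr_eq0 expf_eq0 => /eqP.
  have CD : C * D ^+ 2 != 0.
    apply: contraNneq disc0 => E0.
    transitivity (- (C * D ^+ 2) == 0); last by rewrite E0 oppr0 eqxx.
    by congr (_ == _); rewrite /conic_disc A0 B0; ring.
  have [C0 D0] : C != 0 /\ D != 0.
    by move: CD; rewrite !mulf_eq0 !negb_or => /and3P[].
  have -> : Z = [set rv (- C / D * s ^+ 2 + - E / D * s + - F / D) (0 * s ^+ 2 + 1 * s + 0) | s : K].
    apply/setP => v; rewrite mem_conic; apply/eqP/imsetP => [Ev|[s _ ->]]; last first.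
      by rewrite rv0 rv1 /conic_poly A0 B0; field.
    exists (v 0 1) => //; apply: rowP2; rewrite ?rv0 ?rv1; last by ring.
    apply: (mulfI D0); apply/subr0_eq; rewrite -[RHS]Ev /conic_poly A0 B0.
    by field.
  by apply: param_spectral => //; rewrite mulr1 mulr0 subr0 mulf_neq0 ?oppr_eq0 ?invr_eq0.
(* With [s = x + B y / (2 A)] the equation reads [A s^2 + D s + k y + F = 0], and the discriminant
   is [- A k^2]. *)
pose k := E - D * B / (2 * A).
have EC : C = B ^+ 2 / (4 * A).
  apply: (mulfI (mulf_neq0 n4 A0)); apply: subr0_eq; rewrite -[RHS]qd /quad_disc.
  by field; rewrite A0 n4.
have EE : E = k + D * B / (2 * A) by rewrite /k subrK.
have k0 : k != 0.
  apply: contraNneq disc0 => k0; apply/eqP.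
  transitivity (- A * k ^+ 2); last by rewrite k0; ring.
  by rewrite /k /conic_disc EC; field; rewrite ?A0 ?n2 ?n4.
have -> : Z = [set rv (B / (2 * k) * s ^+ 2 + (1 + B * D / (2 * A * k)) * s + B * F / (2 * A * k))
    (- A / k * s ^+ 2 + - D / k * s + - F / k) | s : K].
  apply/setP => v; rewrite mem_conic; apply/eqP/imsetP => [Ev|[s _ ->]]; last first.
    by rewrite rv0 rv1 /conic_poly EC EE; field; rewrite ?A0 ?k0 ?n2 ?n4.
  have Ey : v 0 1 = - A / k * (v 0 0 + B * v 0 1 / (2 * A)) ^+ 2
      + - D / k * (v 0 0 + B * v 0 1 / (2 * A)) + - F / k.
    apply: (mulfI k0); apply/subr0_eq; rewrite -[RHS]Ev /conic_poly EC EE.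
    by field; rewrite ?A0 ?k0 ?n2 ?n4.
  exists (v 0 0 + B * v 0 1 / (2 * A)) => //; apply: rowP2; rewrite ?rv0 ?rv1 //.
  transitivity ((v 0 0 + B * v 0 1 / (2 * A)) - B / (2 * A) * v 0 1); first by ring.
  by rewrite {2}Ey; field; rewrite ?A0 ?k0 ?n2.
apply: param_spectral => //.
rewrite (_ : _ - _ = A / k) ?mulf_neq0 ?invr_eq0 //; field; by rewrite ?A0 ?n2 ?k0.
Qed.

End ConicSpectral.

Lemma opp_centered_conic (K : finFieldType) (A B C F : K) :
  opp_set (conic_zeros A B C 0 0 F) = conic_zeros A B C 0 0 F.
Proof.
have H (v : 'rV[K]_2) : v \in conic_zeros A B C 0 0 F -> - v \in conic_zeros A B C 0 0 F.
  by rewrite !mem_conic !mxE => /eqP Ev; apply/eqP; rewrite -[RHS]Ev /conic_poly; ring.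
apply/setP => v; apply/imsetP/idP => [[s /H sS -> //]|/H vS].
by exists (- v) => //; rewrite opprK.
Qed.

(** * Numerical thresholds *)

(** [m] is the square root of [q] rounded up, an integer stand-in for it in [mixing]. *)
Lemma double_square_approx q : exists2 m, (q <= m ^ 2)%N & (m ^ 2 <= 2 * q)%N.
Proof.
have ex : exists m, (q <= m ^ 2)%N by exists q; case: q => // q; rewrite -mulnn leq_pmull.
exists (ex_minn ex); case: ex_minnP => // -[|k] _ Hmin //.
have : (k ^ 2 < q)%N by rewrite ltnNge; apply/negP => /Hmin; rewrite ltnn.
rewrite -!mulnn; nia.
Qed.

(** Everything is measured in [r], the eighth root of [q]: [q * m] is at most [2 * r ^+ 12] and [e]
    at least [c * r ^+ 15]. In the last bound both sides have exponent 60, so only the constants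
    decide; this is where 15/8 comes from. *)
Lemma threshold_bounds (R : realType) (c : R) (q e m : nat) :
  1000 <= c -> c * q%:R `^ (15 / 8) <= e%:R -> (0 < q)%N -> (m ^ 2 <= 2 * q)%N ->
  [/\ (256 * q * m < e)%N,
      forall n, (e ^ 2 <= 16 * q ^ 2 * n -> 128 * q * m < n)%N
    & forall n, (e ^ 4 <= 1024 * q ^ 6 * n -> 128 * q * m < n)%N].
Proof.
move=> c1000 He q0 mq.
pose r : R := q%:R `^ (1 / 8).
have r0 : 0 <= r by rewrite powR_ge0.
have qr : q%:R = r ^+ 8.
  by rewrite -powR_mulrn // /r -powRrM mul1r mulVf ?powRr1 // pnatr_eq0.
have r1 : 1 <= r.
  rewrite leNgt; apply/negP => rlt; have := exprn_ilt1 8 r0 rlt.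
  by rewrite -qr ltNge ler1n q0.
have er : c * r ^+ 15 <= e%:R.
  by rewrite -(@powR_mulrn _ r 15) // /r -powRrM mul1r [8%:R^-1 * _]mulrC.
have mr : m%:R <= 2 * r ^+ 4.
  rewrite -(@ler_pXn2r _ 2) ?nnegrE ?mulr_ge0 ?exprn_ge0 //.
  apply: (@le_trans _ _ (2 * q%:R)); first by rewrite -natrX -natrM ler_nat.
  by rewrite exprMn -exprM -qr -natrX ler_wpM2r // ler_nat.
have rn k : 1 <= r ^+ k by rewrite exprn_ege1.
have qm k : (k * q * m)%:R <= k%:R * 2 * r ^+ 12.
  rewrite !natrM qr; apply: (@le_trans _ _ (k%:R * r ^+ 8 * (2 * r ^+ 4))).
    by rewrite ler_wpM2l // mulr_ge0 ?exprn_ge0.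
  by rewrite le_eqVlt; apply/orP; left; apply/eqP; ring.
have c0 : 0 <= c by apply: le_trans c1000.
have e0 : 0 <= c * r ^+ 15 by rewrite mulr_ge0 ?exprn_ge0.
split.
- rewrite -(ltr_nat R); apply: (le_lt_trans (qm 256%N)); apply: lt_le_trans er.
  have -> : c * r ^+ 15 = c * r ^+ 3 * r ^+ 12 by ring.
  rewrite ltr_pM2r ?(lt_le_trans ltr01 (rn _)) //.
  apply: (@lt_le_trans _ _ 1000); first by rewrite -natrM ltr_nat.
  by apply: le_trans c1000 _; rewrite ler_peMr.
- move=> n; rewrite -(ler_nat R) => Hn; rewrite ltnNge; apply/negP.
  rewrite -(ler_nat R) => /le_trans /(_ (qm 128%N)) nle.
  have : (c * r ^+ 15) ^+ 2 <= 16 * r ^+ 16 * (256 * r ^+ 12).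
    apply: (@le_trans _ _ (e%:R ^+ 2)); first by rewrite ler_pXn2r ?nnegrE.
    rewrite -natrX; apply: le_trans Hn _; rewrite (natrM _ (16 * q ^ 2)) (natrM _ 16) (natrX _ q 2) qr -exprM.
    rewrite ler_wpM2l ?mulr_ge0 ?exprn_ge0 //; apply: le_trans nle _.
    by rewrite ler_wpM2r ?exprn_ge0 // -natrM ler_nat.
  have -> : (c * r ^+ 15) ^+ 2 = (c ^+ 2 * r ^+ 2) * r ^+ 28 by ring.
  have -> : 16 * r ^+ 16 * (256 * r ^+ 12) = 4096 * r ^+ 28 by ring.
  rewrite ler_pM2r ?(lt_le_trans ltr01 (rn _)) //; apply/negP; rewrite -ltNge.
  apply: (@lt_le_trans _ _ (c ^+ 2)); last by rewrite ler_peMr // exprn_ge0.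
  by nra.
- move=> n; rewrite -(ler_nat R) => Hn; rewrite ltnNge; apply/negP.
  rewrite -(ler_nat R) => /le_trans /(_ (qm 128%N)) nle.
  have : (c * r ^+ 15) ^+ 4 <= 1024 * r ^+ 48 * (256 * r ^+ 12).
    apply: (@le_trans _ _ (e%:R ^+ 4)); first by rewrite ler_pXn2r ?nnegrE.
    rewrite -natrX; apply: le_trans Hn _; rewrite (natrM _ (1024 * q ^ 6)) (natrM _ 1024) (natrX _ q 6) qr -exprM.
    rewrite ler_wpM2l ?mulr_ge0 ?exprn_ge0 //; apply: le_trans nle _.
    by rewrite ler_wpM2r ?exprn_ge0 // -natrM ler_nat.
  have -> : (c * r ^+ 15) ^+ 4 = c ^+ 4 * r ^+ 60 by ring.
  have -> : 1024 * r ^+ 48 * (256 * r ^+ 12) = 1024 * 256 * r ^+ 60 by ring.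
  rewrite ler_pM2r ?(lt_le_trans ltr01 (rn _)) //; apply/negP; rewrite -ltNge.
  apply: (@lt_le_trans _ _ (1000 * 1000)); first by lra.
  have c2 : 1000 * 1000 <= c ^+ 2 by nra.
  by rewrite (_ : c ^+ 4 = c ^+ 2 * c ^+ 2); [nra|ring].
Qed.

(** * The two cases of the theorem *)

Theorem mainTheorem3 (R : realType) :
  exists c0 : R, forall c : R, c0 <= c ->
  forall (K : finFieldType) (E : {set 'rV[K]_2}) (A B C D E' F : K),
  odd #|K| ->
  c * #|K|%:R `^ (15 / 8) <= #|E|%:R ->
  \det (conic_mx A B C D E' F) != 0 ->
  let Zf := conic_zeros A B C D E' F in
  (\det (conic_quad_mx A B C) != 0 ->
     exists S : {set 'rV[K]_2},
       [/\ is_translation S Zf,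
           (2 <= VCdim (hclass Zf E))%N,
           (VCdim (hclass Zf E) <= VCdim (hclass S E))%N
         & VCdim (hclass S E) = 3%N]) /\
  (\det (conic_quad_mx A B C) = 0 ->
     forall S : {set 'rV[K]_2}, is_translation S Zf ->
       VCdim (hclass S E) = 2%N /\
       (3 <= VCdim (hclass (S :|: opp_set S) E))%N).
Proof.
exists 1000 => c c1000 K E A B C D E' F oK HE det0 Zf.
have n4 : 4%:R != 0 :> K.
  by rewrite (_ : 4%:R = 2%:R * 2%:R) ?mulf_neq0 ?odd_card_two_neq0 // -natrM.
have disc0 : conic_disc A B C D E' F != 0 by rewrite -det_conic_mx // mulf_neq0.
have [psi psiP] := addchar_exists K.
have [m qm mq] := double_square_approx #|K|.
have q0 : (0 < #|K|)%N by apply/card_gt0P; exists 0.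
have [l1 l2 l4] := threshold_bounds c1000 HE q0 mq.
have m0 : (0 < m)%N by move: (leq_trans q0 qm); rewrite expn_gt0 orbF.
have ge2 S : spectral psi S -> (forall v, v != 0 -> (#|self_cap S v| <= 2)%N) ->
    (2 <= VCdim (hclass S E))%N.
  move=> sS cap; have [_ Sge Sle] := sS.
  apply: (VCdim_ge2_large (fun P Q => mixing psiP P Q sS qm)) => // v v0.
  exact: leq_trans (cap v v0) _.
have ge3 S : spectral psi S ->
    (forall v, v != 0 -> (#|self_cap (S :|: opp_set S) v| <= 8)%N) ->
    (3 <= VCdim (hclass (S :|: opp_set S) E))%N.
  move=> sS cap; have [_ Sge Sle] := sS.
  exact: (VCdim_ge3_large (fun P Q => mixing psiP P Q sS qm)).
split=> [det2|det2 S [t ->]].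
  have qd : quad_disc A B C != 0 by rewrite -det_conic_quad_mx // mulf_neq0.
  have [t [F0 [F00 ES]]] := conic_center disc0 qd.
  set S := conic_zeros A B C 0 0 F0 in ES *.
  have discS : conic_disc A B C 0 0 F0 != 0.
    apply: contraNneq (mulf_neq0 qd F00) => <-; rewrite /conic_disc /quad_disc.
    by apply/eqP; ring.
  have capZ v : v != 0 -> (#|self_cap Zf v| <= 2)%N := conic_self_cap oK disc0 qd.
  have capS v : v != 0 -> (#|self_cap S v| <= 2)%N := conic_self_cap oK discS qd.
  (* The centred conic is its own reflection, so the construction for [S :|: opp_set S] gives three
     points for [S] itself; this is why the centred translate is chosen. *)
  have SS : S :|: opp_set S = S by rewrite opp_centered_conic setUid.
  have S3 : VCdim (hclass S E) = 3%N.
    apply/eqP; rewrite eqn_leq VCdim_le //= -{1}SS; apply: ge3; first exact: conic_spectral.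
    by move=> v v0; rewrite SS; apply: leq_trans (capS v v0) _.
  exists S; split=> //; first by exists t.
    by apply: ge2 => //; apply: nondegenerate_spectral.
  by rewrite S3 VCdim_le.
have qd : quad_disc A B C = 0 by rewrite -det_conic_quad_mx // det2 mulr0.
(* A translate is again a conic with the same quadratic part and discriminant, so the argument runs
   on it directly. *)
rewrite conic_translate.
move: (D - _ - _) (E' - _ - _) (conic_poly _ _ _ _ _ _ _ _) (conic_disc_translate A B C D E' F (t 0 0) (t 0 1)).
move=> D2 E2 F2 E0; rewrite -E0 in disc0.
have sS := parabola_spectral psiP oK disc0 qd.
have cap v : v != 0 -> (#|self_cap (conic_zeros A B C D2 E2 F2) v| <= 1)%N.
  exact: parabola_self_cap.
split; last by apply: ge3 => // v v0; apply: parabola_sym_cap.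
apply/eqP; rewrite eqn_leq VCdim_le //=; apply: ge2 => // v v0.
exact: leq_trans (cap v v0) _.
Qed.
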